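(* Let $I$ be a non-empty set, $T=\{z\in\mathbb{C}:|z|=1\}$, and let $K\subseteq T^I$ be a compact set with $\lambda(K)>0$, where $\lambda$ is the product measure on $T^I$ of the normalised Lebesgue measures $\frac{d\theta}{2\pi}$ on each factor $T$. Then $K$ is a set of uniqueness for $A(\overline{D}^I)$: whenever $f,g\in A(\overline{D}^I)$ satisfy $f|_K=g|_K$, then $f\equiv g$ on $\overline{D}^I$.
   Context: $\overline{D}=\{z\in\mathbb{C}:|z|\le1\}$, $\overline{D}^I$ and $T^I$ carry the product topology, and $\lambda$ is understood as the regular Borel probability product measure on the compact space $T^I$. $A(\overline{D}^I)$ is the set of all functions $f:\overline{D}^I\to\mathbb{C}$ that are continuous on $\overline{D}^I$ and such that for every $i_0\in I$ and every $z=(z_i)_{i\in I}\in\overline{D}^I$, the function $w\mapsto f(\zeta(w))$ belongs to the disc algebra $A(\overline{D})$ (continuous on $\overline{D}$, holomorphic on the open disc), where $\zeta(w)_{i_0}=w$ and $\zeta(w)_i=z_i$ for $i\neq i_0$. *)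

(* Defs.v *)
From HB Require Import structures.
From mathcomp Require Import all_boot all_order all_algebra.
From mathcomp Require Import all_classical all_reals all_analysis.
From mathcomp Require Import complex.
From Stdlib Require List.
Import Order.TTheory GRing.Theory Num.Theory numFieldNormedType.Exports.

Unset Implicit Arguments.
Unset Strict Implicit.
Unset Printing Implicit Defensive.

Local Open Scope classical_set_scope.
Local Open Scope ring_scope.

(* The complex plane C = R[i], viewed as a normed space over itself
   (topology = the usual Euclidean topology given by the modulus). *)
Notation CC R := ((R[i])^o).

Notation CI I R := (prod_topology (fun _ : I => CC R)).

Notation BCI I R := (g_sigma_algebraType (@open (CI I R))).

Definition cpolydisc (I : Type) (R : realType) : set (CI I R) :=
  [set z | forall i, `|z i| <= 1].

Definition torus (I : Type) (R : realType) : set (CI I R) :=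
  [set z | forall i, `|z i| = 1].

Definition upd (I : Type) (R : realType) (z : CI I R) (i0 : I) (w : CC R)
  : CI I R := fun i => if pselect (i = i0) then w else z i.

Definition disc_algebra (R : realType) (h : CC R -> CC R) : Prop :=
  {within [set w : CC R | `|w| <= 1], continuous h} /\
  (forall w : CC R, `|w| < 1 -> derivable h w 1).

(* A(\overline{D}^I) (functions are given on C^I; only their values on the
   closed polydisc matter). *)
Definition A_polydisc (I : Type) (R : realType) (f : CI I R -> CC R) : Prop :=
  {within cpolydisc I R, continuous f} /\
  (forall (i0 : I) (z : CI I R), cpolydisc I R z ->
     @disc_algebra R (fun w => f (upd I R z i0 w))).

Definition angles (R : realType) (A : set (CC R)) : set R :=
  [set t : R | 0 <= t < 2 * pi] `&` [set t : R | A ((cos t +i* sin t)%C)].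

Definition haarT (R : realType) (A : set (CC R)) : \bar R :=
  (lebesgue_measure (angles R A) * ((2 * pi)^-1)%:E)%E.

(* lam is the product measure lambda on T^I of the normalised Lebesgue
   measures: a regular Borel probability measure (on C^I, carried by T^I)
   whose value on every finite-dimensional Borel cylinder
   { z | z_i in A_i for i in J } (J finite) is prod_{i in J} mu(A_i). *)
Definition product_haar (I : Type) (R : realType)
    (lam : {measure set (BCI I R) -> \bar R}) : Prop :=
  [/\ lam setT = 1%E,
      lam (torus I R) = 1%E,
      (forall (s : seq I) (A : I -> set (CC R)),
          Stdlib.Lists.List.NoDup s -> (forall i, <<s @open (CC R) >> (A i)) ->
          lam [set z | forall i, Stdlib.Lists.List.In i s -> A i (z i)] =
          (\prod_(i <- s) haarT R (A i))%E),
      (forall A : set (BCI I R), measurable A ->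
          lam A = ereal_sup [set lam Kc | Kc in
                     [set Kc : set (CI I R) | compact Kc /\ Kc `<=` A]])
    & (forall A : set (BCI I R), measurable A ->
          lam A = ereal_inf [set lam U | U in
                     [set U : set (CI I R) | open U /\ A `<=` U]])].

(* Main.v *)
(** Put h = f - g, which vanishes on K, and let c be a point of the open polydisc
    with finitely many nonzero coordinates; such points are dense, so it is
    enough to show h c = 0.  For a holomorphic function u of one variable, the
    maximum principle applied to the product of the rotates of
    u \o (Moebius map sending 0 to c_i) gives a discrete Jensen inequality:
    |u(c_i)|^m is at most the product of the |u(p_k)|, with one point p_k close
    to the Moebius image of each of the m arcs of length 2 pi / m.  Iterating
    over a finite set s of coordinates,
      |h c|^(m^|s|) <= prod_l |h (p_l)|,
    where l runs over the m^|s| product cells and p_l is close to the cell l.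
    By compactness of K, s and m can be chosen so that |h| <= e at p_l whenever
    the cell l meets K.  The cells meeting K cover K and each has measure
    O(m^-|s|), with a constant depending only on c since the Moebius map is the
    identity for all but finitely many coordinates; hence they are a fixed
    positive proportion of all cells, and letting e tend to 0 gives h c = 0.
    The maximum principle itself is derived from Goursat's subdivision
    argument, run on Riemann sums of the contour integral of u(e^(x + i y)) over
    a rectangle of height 2 pi. *)
Require Import Defs.
From HB Require Import structures.
From mathcomp Require Import all_boot all_order all_algebra.
From mathcomp Require Import all_classical all_reals all_analysis.
From mathcomp Require Import complex.
From mathcomp Require Import measurable_realfun ring lra zify.
Import Order.TTheory GRing.Theory Num.Theory numFieldNormedType.Exports.
Import Normc.
Set Implicit Arguments.
Unset Strict Implicit.
Local Open Scope classical_set_scope.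
Local Open Scope ring_scope.
Local Open Scope complex_scope.
Local Notation Re := complex.Re.
Local Notation Im := complex.Im.

(** * Modulus on the complex numbers *)

Section ComplexNorm.
Context {R : realType}.
Local Notation C := R[i].
Implicit Types z w : C.

Lemma norm_normc z : `|z| = (normc z)%:C.
Proof. by case: z. Qed.

Lemma normc_ge0 z : 0 <= normc z.
Proof. by rewrite -lecR -norm_normc normr_ge0. Qed.

Lemma normcD z w : normc (z + w) <= normc z + normc w.
Proof. by rewrite -lecR rmorphD /= -!norm_normc ler_normD. Qed.

Lemma normc_opp z : normc (- z) = normc z.
Proof. by apply: complexI; rewrite -!norm_normc normrN. Qed.

Lemma normcB z w : normc (z - w) <= normc z + normc w.
Proof. by rewrite -(normc_opp w) normcD. Qed.

Lemma normcBC z w : normc (z - w) = normc (w - z).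
Proof. by rewrite -normc_opp opprB. Qed.

Lemma normc_sub_le w z : normc z <= normc w + normc (z - w).
Proof. by apply: le_trans (normcD _ _); rewrite addrC subrK. Qed.

Lemma normcX z n : normc (z ^+ n) = normc z ^+ n.
Proof. by elim: n => [|n IH]; rewrite ?expr0 ?normc1 // !exprS normcM IH. Qed.

Lemma normc_prod (J : Type) (r : seq J) (F : J -> C) :
  normc (\prod_(i <- r) F i) = \prod_(i <- r) normc (F i).
Proof. by rewrite (big_morph (@normc R) (@normcM R) (@normc1 R)). Qed.

Lemma normc_sum (J : Type) (r : seq J) (P : pred J) (F : J -> C) :
  normc (\sum_(i <- r | P i) F i) <= \sum_(i <- r | P i) normc (F i).
Proof.
elim/big_ind2: _ => [|z1 w1 z2 w2 h1 h2|//]; first by rewrite normc0.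
by rewrite (le_trans (normcD _ _)) ?lerD.
Qed.

Lemma normc_real (x : R) : normc x%:C = `|x|.
Proof. by rewrite /= expr0n addr0 sqrtr_sqr. Qed.

Lemma normc_i : normc ('i : C) = 1.
Proof. by rewrite /= expr0n add0r expr1n sqrtr1. Qed.

Lemma normc_sqr z : normc z ^+ 2 = Re z ^+ 2 + Im z ^+ 2.
Proof. by case: z => x y /=; rewrite sqr_sqrtr ?addr_ge0 ?sqr_ge0. Qed.

Lemma normc_le_ReIm z : normc z <= `|Re z| + `|Im z|.
Proof.
have -> : z = (Re z)%:C + 'i * (Im z)%:C by exact: complexE.
apply: le_trans (normcD _ _) _; rewrite normcM normc_i mul1r !normc_real.
by rewrite -complexE.
Qed.

Lemma normc_eq0 z : (normc z == 0) = (z == 0).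
Proof.
by apply/eqP/eqP => [/eq0_normc //|->]; rewrite normc0.
Qed.

Lemma norm_le1 z : (`|z| <= 1) = (normc z <= 1).
Proof. by rewrite norm_normc -lecR. Qed.

Lemma norm_lt1 z : (`|z| < 1) = (normc z < 1).
Proof. by rewrite norm_normc -ltcR. Qed.

Lemma norm_eq1 z : `|z| = 1 <-> normc z = 1.
Proof.
rewrite norm_normc; split=> [|->//].
by move/(congr1 (@Re R)).
Qed.

Lemma complex_gt0 (e : C) : 0 < e -> exists2 r : R, 0 < r & e = r%:C.
Proof. by case: e => x y; rewrite ltcE /= => /andP[/eqP -> x0]; exists x. Qed.

End ComplexNorm.

(** Stated over an arbitrary numeric field so that it serves both the real functions exp, sin, cos
    and complex derivatives. Clearing the difference quotient of its denominator also admits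
    [h = 0]. *)
Lemma derivable_littleo (K : numFieldType) (f : K^o -> K^o) (x : K) :
  derivable f x 1 -> forall e : K, 0 < e -> exists2 d : K, 0 < d &
    forall h : K, `|h| < d -> `|f (x + h) - f x - 'D_1 f x * h| <= e * `|h|.
Proof.
move=> fc e e0; move/cvgrPdist_le: (fc) => /(_ e e0); rewrite -/('D_1 f x).
move: ('D_1 f x) => c.
rewrite /dnbhs /= /within /= => /nbhs_ballP[d /= d0 H].
exists d => // h hd.
have [->|h0] := eqVneq h 0.
  by rewrite addr0 subrr mulr0 subr0 normr0 mulr0.
have := H h; rewrite /ball /= sub0r normrN => /(_ hd h0).
have -> : c - h^-1 *: (f (h *: (1 : K^o) + x) - f x) = - (h^-1 * (f (x + h) - f x - c * h)).
  rewrite [h *: _]mulr1 [h + x]addrC /GRing.scale /=; by field.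
by rewrite normrN normrM normrV ?unitfE // mulrC ler_pdivrMr ?normr_gt0.
Qed.

(** * The complex exponential and complex differentiability *)

Section PolarCoordinates.
Context {R : realType}.

(** This is e^(x + i y): the logarithm of the modulus comes first, the angle second. *)
Definition polar (x y : R) : R[i] := (expR x * cos y) +i* (expR x * sin y).

Lemma polarD x y a b : polar (x + a) (y + b) = polar x y * polar a b.
Proof.
rewrite /polar expRD cosD sinD; apply/eqP; rewrite eq_complex /=.
by apply/andP; split; apply/eqP; ring.
Qed.

Lemma polar00 : polar 0 0 = 1.
Proof. by rewrite /polar expR0 cos0 sin0 !mul1r. Qed.

Lemma normc_polar x y : normc (polar x y) = expR x.
Proof.
rewrite /= !exprMn -mulrDr cos2Dsin2 mulr1 sqrtr_sqr ger0_norm ?expR_ge0 //.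
Qed.

Lemma polar_2pi x y : polar x (y + 2 * pi) = polar x y.
Proof. by rewrite /polar mulr_natl cosD2pi sinD2pi. Qed.

Lemma littleo_at0 (f : R -> R) (d : R) : is_derive (0 : R) (1 : R) f d ->
  forall e : R, 0 < e -> exists2 r : R, 0 < r &
    forall h : R, `|h| < r -> `|f h - f 0 - d * h| <= e * `|h|.
Proof.
move=> fd e e0; have df : derivable f 0 1 by exact: ex_derive.
have [r r0 H] := @derivable_littleo _ f 0 df e e0.
by exists r => // h /H; rewrite add0r (@derive_val _ _ _ _ _ _ _ fd).
Qed.

Lemma polar_littleo (e : R) : 0 < e -> exists2 d : R, 0 < d &
  forall a b, `|a| < d -> `|b| < d ->
    normc (polar a b - 1 - (a +i* b)) <= e * (`|a| + `|b|).
Proof.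
move=> e0.
(* The error terms below add up to at most 5 m |a| + 3 m |b|, so 6 m <= e leaves room. *)
have [m m0 [m1 me]] : exists2 m : R, 0 < m & m <= 1 /\ m * 6 <= e.
  exists (Num.min 1 (e / 6)); first by rewrite lt_min ltr01 divr_gt0.
  by split; rewrite -?ler_pdivlMr // ge_min lexx ?orbT.
have [d1 d10 H1] := littleo_at0 (is_derive_expR 0) m0.
have [d2 d20 H2] := littleo_at0 (is_derive_sin 0) m0.
have [d3 d30 H3] := littleo_at0 (is_derive_cos 0) m0.
exists (Num.min m (Num.min d1 (Num.min d2 d3))); first by rewrite !lt_min m0 d10 d20 d30.
move=> a b; rewrite !lt_min => /and4P[am ad1 _ _] /and4P[bm _ bd2 bd3].
have := H1 _ ad1; have := H2 _ bd2; have := H3 _ bd3.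
rewrite expR0 sin0 cos0 oppr0 !mul0r !subr0 ?addr0 !mul1r.
move: (cos_max b).
have -> : polar a b - 1 - (a +i* b) =
   ((expR a - 1 - a) * cos b + (1 + a) * (cos b - 1)) +i* ((expR a - 1) * sin b + (sin b - b)).
  by rewrite /polar; apply/eqP; rewrite eq_complex /=; apply/andP; split; apply/eqP; ring.
set X := expR a - 1 - a; set Y := cos b - 1; set Z := sin b - b.
move=> c1 hY hZ hX; apply: le_trans (normc_le_ReIm _) _ => /=.
have -> : expR a - 1 = X + a by rewrite /X; ring.
have -> : sin b = Z + b by rewrite /Z; ring.
have h1 : `|X * cos b| <= m * `|a|.
  rewrite normrM -[leRHS]mulr1; apply: ler_pM => //.
have h2 : `|(1 + a) * Y| <= 2 * (m * `|b|).
  rewrite normrM; apply: ler_pM => //; apply: le_trans (ler_normD _ _) _.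
  rewrite normr1; lra.
have ma : m * `|a| <= `|a| by rewrite ler_piMl.
have mb : m * `|b| <= `|b| by rewrite ler_piMl.
have h3 : `|(X + a) * (Z + b)| <= (2 * `|a|) * (2 * m).
  rewrite normrM; apply: ler_pM => //.
    by apply: le_trans (ler_normD _ _) _; lra.
  by apply: le_trans (ler_normD _ _) _; lra.
apply: le_trans (lerD (ler_normD _ _) (ler_normD _ _)) _.
have := normr_ge0 a; have := normr_ge0 b; nra.
Qed.

Definition cdiff (f : R[i] -> R[i]) (w : R[i]) := exists c, forall e : R, 0 < e ->
  exists2 d : R, 0 < d & forall v, normc (v - w) < d ->
    normc (f v - f w - c * (v - w)) <= e * normc (v - w).

(** A single complex factor [c] multiplies the increment, so this is complex differentiability of G
    at x + i y, with the plane in real coordinates; the Cauchy-Riemann equations are built in. *)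
Definition cdiff2 (G : R -> R -> R[i]) (x y : R) := exists c, forall e : R, 0 < e ->
  exists2 d : R, 0 < d & forall x' y', `|x' - x| < d -> `|y' - y| < d ->
    normc (G x' y' - G x y - c * ((x' - x) +i* (y' - y)))
      <= e * (`|x' - x| + `|y' - y|).

(** The chain rule for f composed with the exponential. The error splits into that of f along the
    increment of the exponential and [c] times that of the exponential itself; each gets e / 2. *)
Lemma cdiff_polar (f : R[i] -> R[i]) x y :
  cdiff f (polar x y) -> cdiff2 (fun x y => f (polar x y)) x y.
Proof.
move=> [c fc]; exists (c * polar x y) => e e0.
set W := expR x; have W0 : 0 < W by exact: expR_gt0.
(* The increment of the exponential is at most 2 W (|a| + |b|), so [e1] turns the error of f into e
   / 2 times |a| + |b|. *)
pose e1 := e / (4 * W); have e10 : 0 < e1 by rewrite divr_gt0 // mulr_gt0.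
pose nc := normc c; have nc0 : 0 <= nc by exact: normc_ge0.
have [e2 e20 [e21 e22]] : exists2 e2 : R, 0 < e2 & e2 <= 1 /\ e2 * (W * (nc + 1)) <= e / 2.
  have W1 : 0 < 2 * W * (nc + 1) by rewrite !mulr_gt0 // ltr_wpDl.
  exists (Num.min 1 (e / (2 * W * (nc + 1)))); first by rewrite lt_min ltr01 divr_gt0.
  split; first by rewrite ge_min lexx.
  apply: le_trans (_ : e / (2 * W * (nc + 1)) * (W * (nc + 1)) <= _).
    by rewrite ler_wpM2r ?mulr_ge0 ?addr_ge0 ?(ltW W0) // ge_min lexx orbT.
  rewrite le_eqVlt; apply/orP; left; apply/eqP; field.
  by rewrite !lt0r_neq0 // ltr_wpDl.
have [d1 d10 H1] := fc e1 e10; have [d2 d20 H2] := polar_littleo e20.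
exists (Num.min d2 (d1 / (8 * W))); first by rewrite lt_min d20 divr_gt0 // mulr_gt0.
move=> x' y'; set a := x' - x; set b := y' - y.
rewrite !lt_min => /andP[a2 a1] /andP[b2 b1].
have -> : polar x' y' = polar x y * polar a b.
  by rewrite -polarD /a /b; congr polar; ring.
have dE : polar x y * polar a b - polar x y = polar x y * (polar a b - 1 - (a +i* b)) + polar x y * (a +i* b) by ring.
have ab : normc (a +i* b) <= `|a| + `|b| by exact: normc_le_ReIm.
have h := H2 _ _ a2 b2.
have a0 := normr_ge0 a; have b0 := normr_ge0 b.
have h' : normc (polar a b - 1 - (a +i* b)) <= `|a| + `|b|.
  by apply: le_trans h _; rewrite ler_piMl // addr_ge0.
have hw : normc (polar x y * polar a b - polar x y) <= 2 * W * (`|a| + `|b|).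
  rewrite dE; apply: le_trans (normcD _ _) _; rewrite !normcM normc_polar -/W; nra.
have hd : normc (polar x y * polar a b - polar x y) < d1.
  apply: le_lt_trans hw _; move: a1 b1; rewrite !ltr_pdivlMr ?mulr_gt0 //; nra.
have -> : f (polar x y * polar a b) - f (polar x y) - c * polar x y * (a +i* b) =
  (f (polar x y * polar a b) - f (polar x y) - c * (polar x y * polar a b - polar x y))
  + c * (polar x y * (polar a b - 1 - (a +i* b))).
  by ring.
apply: le_trans (normcD _ _) _; rewrite !normcM normc_polar -/W -/nc.
have k1 : e1 * (2 * W * (`|a| + `|b|)) = e / 2 * (`|a| + `|b|).
  rewrite /e1; field; exact: lt0r_neq0.
have k2 : nc * (W * (e2 * (`|a| + `|b|))) <= e / 2 * (`|a| + `|b|).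
  rewrite !mulrA ler_wpM2r ?addr_ge0 //; apply: le_trans e22.
  have := mulr_ge0 (ltW e20) (ltW W0); nra.
have k3 := H1 _ hd.
have k4 : e1 * normc (polar x y * polar a b - polar x y) <= e1 * (2 * W * (`|a| + `|b|)).
  by rewrite ler_wpM2l // ltW.
have k5 : nc * (W * normc (polar a b - 1 - (a +i* b))) <= nc * (W * (e2 * (`|a| + `|b|))).
  by rewrite !ler_wpM2l // ltW.
lra.
Qed.

End PolarCoordinates.

(** * Goursat's theorem *)

Section Goursat.
Context {R : realType}.
Local Notation C := R[i].

(** Every left endpoint lies below every right endpoint, so the supremum of the left endpoints is a
    common point. *)
Lemma nested_intervals (x a : nat -> R) :
  (forall k, 0 <= a k) ->
  (forall k, x k <= x k.+1 /\ x k.+1 + a k.+1 <= x k + a k) ->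
  exists u, forall k, x k <= u /\ u <= x k + a k.
Proof.
move=> a0 H.
have up j k : x k <= x (j + k)%N /\ x (j + k)%N + a (j + k)%N <= x k + a k.
  elim: j => [|j [IH1 IH2]]; first by rewrite add0n.
  by have [h1 h2] := H (j + k)%N; rewrite addSn; split; [exact: le_trans h1|exact: le_trans IH2].
have cross k l : x k <= x l + a l.
  apply: (@le_trans _ _ (x (l + k)%N)); first exact: (up l k).1.
  by rewrite addnC; apply: le_trans (up k l).2; rewrite lerDl.
exists (sup (range x)) => k; split.
  apply: ub_le_sup; last by exists k.
  by exists (x 0%N + a 0%N) => _ [l _ <-]; exact: cross.
apply: ge_sup; first by exists (x 0%N), 0%N.
by move=> _ [l _ <-]; exact: cross.
Qed.

Variable G : R -> R -> C.

Definition left_sum N x a (F : R -> C) := \sum_(k < N) F (x + k%:R * (a / N%:R)).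

Lemma left_sum_double N x a F : left_sum (N + N) x a F =
  left_sum N x (a / 2) F + left_sum N (x + a / 2) (a / 2) F.
Proof.
case: N => [|N]; first by rewrite /left_sum !big_ord0 addr0.
have N0 : N.+1%:R != 0 :> R by rewrite pnatr_eq0.
have half : a / (N.+1 + N.+1)%:R = a / 2 / N.+1%:R.
  by rewrite addnn -mul2n natrM invfM mulrA.
rewrite /left_sum big_split_ord /= half; congr (_ + _).
apply: eq_bigr => k _; congr F.
by rewrite natrD mulrDl [_ * (a / 2 / _)]mulrC divfK // addrA.
Qed.

(* Left Riemann sums of the contour integral of [G] over the boundary of the
   rectangle with lower left corner (x, y) and sides a, b.  Because opposite
   sides are sampled at matching points, this is exactly 0 for affine [G]. *)
Definition contour_sum N x y a b : C :=
  (a / N%:R)%:C * (left_sum N x a (G^~ y) - left_sum N x a (G^~ (y + b)))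
  + 'i * (b / N%:R)%:C * (left_sum N y b (G (x + a)) - left_sum N y b (G x)).

(** Both sides use the same step, so the sums along the two inner segments occur twice with opposite
    signs and cancel exactly. *)
Lemma contour_sum_double N x y a b : contour_sum (N + N) x y a b =
    contour_sum N x y (a / 2) (b / 2) + contour_sum N (x + a / 2) y (a / 2) (b / 2)
  + contour_sum N x (y + b / 2) (a / 2) (b / 2)
  + contour_sum N (x + a / 2) (y + b / 2) (a / 2) (b / 2).
Proof.
rewrite /contour_sum !left_sum_double.
have half c : c / (N + N)%:R = c / 2 / N%:R :> R.
  by rewrite addnn -mul2n natrM invfM mulrA.
have dbl z c : z + c / 2 + c / 2 = z + c :> R by lra.
rewrite !half !dbl; ring.
Qed.

(** The affine part cancels, and each pair of opposite samples leaves an error of at most 2 e,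
    weighted by the lengths a and b. *)
Lemma contour_sum_near_affine N (x y a b e u v : R) (c g : C) : (0 < N)%N -> 0 <= a -> 0 <= b ->
  (forall x' y' : R, x <= x' <= x + a -> y <= y' <= y + b ->
    normc (G x' y' - g - c * ((x' - u) +i* (y' - v))) <= e) ->
  normc (contour_sum N x y a b) <= 2 * e * (a + b).
Proof.
move=> N0 a0 b0 H; have N0' : 0 < N%:R :> R by rewrite ltr0n.
have nN0 : N%:R != 0 :> R by rewrite gt_eqF.
(* Opposite samples are paired and the increment of the affine part is removed from each pair. The
   two corrections, a (c i b) and - i b (c a), cancel in total. *)
have -> : contour_sum N x y a b =
   (a / N%:R)%:C * \sum_(k < N) (G (x + k%:R * (a / N%:R)) y
        - G (x + k%:R * (a / N%:R)) (y + b) + c * 'i * b%:C)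
 + 'i * (b / N%:R)%:C * \sum_(k < N) (G (x + a) (y + k%:R * (b / N%:R))
        - G x (y + k%:R * (b / N%:R)) - c * a%:C).
  rewrite /contour_sum /left_sum !(sumrB, big_split) /= !sumr_const !card_ord.
  rewrite -(mulr_natr (c * 'i * b%:C)) -(mulr_natr (c * a%:C)).
  have -> : N%:R = (N%:R : R)%:C :> C by rewrite rmorph_nat.
  set S1 := \sum_(k < N) _; set S2 := \sum_(k < N) _; set S3 := \sum_(k < N) _; set S4 := \sum_(k < N) _.
  have A1 : (a / N%:R)%:C * (N%:R)%:C = a%:C :> C by rewrite -rmorphM /= divfK.
  have A2 : (b / N%:R)%:C * (N%:R)%:C = b%:C :> C by rewrite -rmorphM /= divfK.
  rewrite -A1 -A2; move: (_%:C) (_%:C) (_%:C) S1 S2 S3 S4 => al n be S1 S2 S3 S4 {A1 A2}.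
  ring.
have ind k (kN : (k < N)%N) (z s : R) : 0 <= s -> z <= z + k%:R * (s / N%:R) <= z + s.
  move=> s0; have kN1 : k%:R / N%:R <= 1 :> R by rewrite ler_pdivrMr // mul1r ler_nat ltnW.
  have -> : k%:R * (s / N%:R) = s * (k%:R / N%:R) by rewrite mulrCA.
  have k0 : 0 <= k%:R / N%:R :> R by rewrite divr_ge0 ?ler0n.
  by apply/andP; split; [rewrite lerDl mulr_ge0|rewrite lerD2l ler_piMr].
have e1 (k : 'I_N) : normc (G (x + k%:R * (a / N%:R)) y
        - G (x + k%:R * (a / N%:R)) (y + b) + c * 'i * b%:C) <= 2 * e.
  have [h1 h2] : (y <= y <= y + b) /\ (y <= y + b <= y + b) by rewrite !lexx lerDl b0.
  have xk := ind k (ltn_ord k) x a a0.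
  have := H _ _ xk h1; have := H _ _ xk h2; move: (x + _) => x' k1 k2.
  rewrite [2 * e]mulr_natl mulr2n.
  apply: le_trans (lerD k2 k1); apply: le_trans (normcB _ _).
  rewrite le_eqVlt; apply/orP; left; apply/eqP; congr normc.
  have -> : (x' - u) +i* (y + b - v) = (x' - u) +i* (y - v) + 'i * b%:C.
    by apply/eqP; rewrite eq_complex /=; apply/andP; split; apply/eqP; ring.
  ring.
have e2 (k : 'I_N) : normc (G (x + a) (y + k%:R * (b / N%:R))
        - G x (y + k%:R * (b / N%:R)) - c * a%:C) <= 2 * e.
  have [h1 h2] : (x <= x <= x + a) /\ (x <= x + a <= x + a) by rewrite !lexx lerDl a0.
  have yk := ind k (ltn_ord k) y b b0.
  have := H _ _ h1 yk; have := H _ _ h2 yk; move: (y + _) => y' k1 k2.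
  rewrite [2 * e]mulr_natl mulr2n.
  apply: le_trans (lerD k1 k2); apply: le_trans (normcB _ _).
  rewrite le_eqVlt; apply/orP; left; apply/eqP; congr normc.
  have -> : (x + a - u) +i* (y' - v) = (x - u) +i* (y' - v) + a%:C.
    by apply/eqP; rewrite eq_complex /=; apply/andP; split; apply/eqP; ring.
  ring.
have bnd (F : 'I_N -> C) (s : R) : 0 <= s -> (forall k, normc (F k) <= 2 * e) ->
    normc ((s / N%:R)%:C * \sum_(k < N) F k) <= 2 * e * s.
  move=> s0 HF; rewrite normcM normc_real ger0_norm ?divr_ge0 ?ler0n //.
  have -> : 2 * e * s = s / N%:R * (2 * e *+ N).
    by rewrite -mulr_natr; field.
  rewrite ler_wpM2l ?divr_ge0 ?ler0n //; apply: le_trans (normc_sum _ _ _) _.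
  by rewrite -[N in leRHS]card_ord -sumr_const ler_sum.
rewrite mulrDr; apply: le_trans (normcD _ _) _; apply: lerD; first exact: bnd.
by rewrite -mulrA normcM normc_i mul1r; exact: bnd.
Qed.

(** If the bound fails, it fails on one quarter after each bisection; differentiability at the
    common point of the nested rectangles contradicts this. Finite sums replace integrals
    throughout, so no limit of the sums has to exist. *)
Lemma goursat (x y a b : R) : 0 <= a -> 0 <= b ->
  (forall x' y' : R, x <= x' <= x + a -> y <= y' <= y + b -> cdiff2 G x' y') ->
  forall e : R, 0 < e -> exists2 N, (0 < N)%N &
    normc (contour_sum N x y a b) <= 2 * e * (a + b) ^+ 2.
Proof.
move=> a0 b0 dG e e0.
(* The bound is asked for all large powers of 2, so that thresholds of the four quarters can be
   combined. Its quadratic form makes the bounds of the quarters add up to that of the whole. *)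
pose good (x y a b : R) := exists n0, forall n, (n0 <= n)%N ->
  normc (contour_sum (2 ^ n) x y a b) <= 2 * e * (a + b) ^+ 2.
suff [n0 /(_ n0 (leqnn _)) H] : good x y a b by exists (2 ^ n0)%N; rewrite ?expn_gt0.
pose q (p : R * R) (d : bool * bool) (k : nat) : R * R :=
  (p.1 + d.1%:R * (a / 2 ^+ k.+1), p.2 + d.2%:R * (b / 2 ^+ k.+1)).
have quarter (p : R * R) k : (forall d, good (q p d k).1 (q p d k).2 (a / 2 ^+ k.+1) (b / 2 ^+ k.+1)) ->
    good p.1 p.2 (a / 2 ^+ k) (b / 2 ^+ k).
  move=> H; have [[n1 g1] [n2 g2] [n3 g3] [n4 g4]] :=
    And4 (H (false, false)) (H (true, false)) (H (false, true)) (H (true, true)).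
  exists (n1 + n2 + n3 + n4).+1 => -[//|n]; rewrite ltnS => nn.
  rewrite expnS mul2n -addnn contour_sum_double.
  have hf c : c / 2 ^+ k / 2 = c / 2 ^+ k.+1 :> R by rewrite exprSr invfM mulrA.
  rewrite !hf.
  have {}g1 := g1 n ltac:(lia); have {}g2 := g2 n ltac:(lia).
  have {}g3 := g3 n ltac:(lia); have {}g4 := g4 n ltac:(lia).
  move: g1 g2 g3 g4; rewrite /q /= !mul0r !mul1r !addr0 => g1 g2 g3 g4.
  have -> : 2 * e * (a / 2 ^+ k + b / 2 ^+ k) ^+ 2 =
     2 * e * (a / 2 ^+ k.+1 + b / 2 ^+ k.+1) ^+ 2 + 2 * e * (a / 2 ^+ k.+1 + b / 2 ^+ k.+1) ^+ 2
   + 2 * e * (a / 2 ^+ k.+1 + b / 2 ^+ k.+1) ^+ 2 + 2 * e * (a / 2 ^+ k.+1 + b / 2 ^+ k.+1) ^+ 2.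
    by rewrite -!hf; field; rewrite expf_neq0.
  by do 3 (apply: le_trans (normcD _ _) (lerD _ _) => //).
apply: contrapT => bad0.
(* The implication sits under the existential so that the choice of a quarter is a total function;
   on good rectangles its value is arbitrary. *)
have step (s : R * R * nat) : exists d, ~ good s.1.1 s.1.2 (a / 2 ^+ s.2) (b / 2 ^+ s.2) ->
    ~ good (q s.1 d s.2).1 (q s.1 d s.2).2 (a / 2 ^+ s.2.+1) (b / 2 ^+ s.2.+1).
  have [g|ng] := pselect (good s.1.1 s.1.2 (a / 2 ^+ s.2) (b / 2 ^+ s.2)); first by exists (false, false).
  have /existsNP[d nd] : ~ forall d, good (q s.1 d s.2).1 (q s.1 d s.2).2 (a / 2 ^+ s.2.+1) (b / 2 ^+ s.2.+1).
    by move=> /quarter.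
  by exists d.
have [f fP] := choice step.
pose s := fix s k := if k is k'.+1 then q (s k') (f (s k', k')) k' else (x, y).
have bad k : ~ good (s k).1 (s k).2 (a / 2 ^+ k) (b / 2 ^+ k).
  by elim: k => [|k IH]; [rewrite /= expr0 !divr1|exact: (fP (s k, k))].
have nest (z c : R) (d : nat -> bool) (t : nat -> R) : 0 <= c ->
    (forall k, t k.+1 = t k + (d k)%:R * (c / 2 ^+ k.+1)) ->
    exists u, forall k, t k <= u /\ u <= t k + c / 2 ^+ k.
  move=> c0 ht; apply: nested_intervals => k; first by rewrite divr_ge0 // exprn_ge0.
  rewrite ht; have p0 : 0 <= c / 2 ^+ k.+1 by rewrite divr_ge0 // exprn_ge0.
  have -> : c / 2 ^+ k = c / 2 ^+ k.+1 + c / 2 ^+ k.+1 by rewrite exprSr invfM mulrA -splitr.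
  by case: (d k); rewrite /= ?mul0r ?mul1r; split; lra.
have [u hu] := nest x a (fun k => (f (s k, k)).1) (fun k => (s k).1) a0 (fun=> erefl).
have [v hv] := nest y b (fun k => (f (s k, k)).2) (fun k => (s k).2) b0 (fun=> erefl).
have [c /(_ e e0)[d d0 H]] : cdiff2 G u v.
  have [u1 u2] := hu 0%N; have [v1 v2] := hv 0%N.
  by move: u1 u2 v1 v2; rewrite /= expr0 !divr1 => u1 u2 v1 v2; apply: dG; apply/andP.
have [k hk] : exists k, (a + b) / 2 ^+ k < d.
  pose k := Num.bound ((a + b) / d); exists k.
  rewrite ltr_pdivrMr ?exprn_gt0 // mulrC -ltr_pdivrMr //.
  apply: lt_trans (archi_boundP _) _; first by rewrite divr_ge0 ?addr_ge0 // ltW.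
  by rewrite -natrX ltr_nat ltn_expl.
apply: (bad k); exists 0%N => n _.
have ak0 : 0 <= a / 2 ^+ k by rewrite divr_ge0 // exprn_ge0.
have bk0 : 0 <= b / 2 ^+ k by rewrite divr_ge0 // exprn_ge0.
move: hk; rewrite mulrDl => hk.
have [u1 u2] := hu k; have [v1 v2] := hv k.
(* On the k-th rectangle G is affine up to e times the sum of its sides; the length of the contour
   supplies the second such factor. *)
rewrite expr2 [2 * e * _]mulrA -(mulrA 2).
apply: (@contour_sum_near_affine _ _ _ _ _ _ u v c (G u v)) => //; first by rewrite expn_gt0.
move=> x' y' /andP[x1 x2] /andP[y1 y2].
have hx : `|x' - u| <= a / 2 ^+ k by rewrite ler_norml; apply/andP; split; lra.
have hy : `|y' - v| <= b / 2 ^+ k by rewrite ler_norml; apply/andP; split; lra.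
apply: le_trans (H _ _ _ _) _; [lra|lra|].
by rewrite ler_wpM2l ?lerD // ltW.
Qed.

End Goursat.

(** * The maximum principle *)

Section MaximumPrinciple.
Context {R : realType}.
Local Notation C := R[i].

Lemma cdiff_continuous (f : C -> C) w : cdiff f w -> forall e : R, 0 < e ->
  exists2 d : R, 0 < d & forall v, normc (v - w) < d -> normc (f v - f w) <= e.
Proof.
move=> [c /(_ 1 ltr01)[d d0 H]] e e0; have c0 := normc_ge0 c.
have c1 : 0 < normc c + 1 by rewrite ltr_wpDl.
exists (Num.min d (e / (normc c + 1))); first by rewrite lt_min d0 divr_gt0.
move=> v; rewrite lt_min ltr_pdivlMr // => /andP[vd ve].
apply: le_trans (normc_sub_le (c * (v - w)) _) _; rewrite normcM.
have := H v vd; rewrite mul1r; move: ve; rewrite mulrDr mulr1; lra.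
Qed.

(** Goursat's bound is applied to P(e^(x + i y)) on [s1, s] x [0, 2 pi]. The horizontal sides cancel
    by periodicity, so the sample means on the circles of radii e^s1 and e^s nearly agree; the first
    is close to P 0 and the second is at most M in modulus. *)
Lemma circle_bound_at0 (P : C -> C) (s M : R) : s < 0 ->
  (forall w, normc w < 1 -> cdiff P w) ->
  (forall t, 0 <= t -> normc (P (polar s t)) <= M) -> normc (P 0) <= M.
Proof.
move=> s0 dP PM; apply/ler_addgt0Pl => e e0.
have e20 : 0 < e / 2 by rewrite divr_gt0.
have [d d0 Hd] : exists2 d : R, 0 < d & forall v, normc (v - 0) < d -> normc (P v - P 0) <= e / 2.
  by apply: cdiff_continuous e20; apply: dP; rewrite normc0 ltr01.
have [s1 s1s s1d] : exists2 s1 : R, s1 < s & expR s1 < d.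
  exists (Num.min (s - 1) (ln d - 1)); first by rewrite gt_min; apply/orP; left; lra.
  rewrite -[ltRHS](@lnK _ d) ?posrE // ltr_expR gt_min; apply/orP; right; lra.
pose b : R := 2 * pi; pose a := s - s1.
have b0 : 0 < b by rewrite mulr_gt0 // pi_gt0.
have a0 : 0 <= a by rewrite subr_ge0 ltW.
have ab0 : 0 < 2 * (a + b) ^+ 2 by rewrite mulr_gt0 // exprn_gt0 // ltr_wpDl.
(* The tolerance is chosen so that the bound reads e / 2 * b: dividing by the height b, the means
   over the vertical sides differ by at most e / 2. *)
have [N N0] : exists2 N, (0 < N)%N &
    normc (contour_sum (fun x y => P (polar x y)) N s1 0 a b)
      <= 2 * (e / 2 * b / (2 * (a + b) ^+ 2)) * (a + b) ^+ 2.
  apply: goursat => //; first exact: ltW; last by rewrite divr_gt0 // mulr_gt0.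
  move=> x y /andP[_ xa] _; apply: cdiff_polar; apply: dP.
  rewrite normc_polar expR_lt1; apply: le_lt_trans xa _; rewrite /a; lra.
have -> : 2 * (e / 2 * b / (2 * (a + b) ^+ 2)) * (a + b) ^+ 2 = e / 2 * b.
  by field; rewrite gt_eqF // ltr_wpDl.
rewrite /contour_sum add0r.
have -> : left_sum N s1 a (fun x => P (polar x b)) = left_sum N s1 a (fun x => P (polar x 0)).
  by apply: eq_bigr => k _; rewrite -[b]add0r polar_2pi.
rewrite subrr mulr0 add0r.
have -> : s1 + a = s by rewrite /a; ring.
rewrite -mulrA !normcM normc_i mul1r normc_real.
have N0' : 0 < N%:R :> R by rewrite ltr0n.
have bN0 : 0 <= b / N%:R by rewrite ltW // divr_gt0.
rewrite (ger0_norm bN0) mulrAC ler_pdivrMr //.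
have -> : e / 2 * b * N%:R = b * (e / 2 * N%:R) by ring.
rewrite ler_pM2l //.
have pt (k : 'I_N) : 0 <= 0 + k%:R * (b / N%:R) by rewrite add0r mulr_ge0.
set S := left_sum _ _ _ _; set S1 := left_sum _ _ _ _ => HS.
have S_le : normc S <= N%:R * M.
  apply: le_trans (normc_sum _ _ _) _.
  apply: le_trans (_ : \sum_(k < N) M <= _); first by apply: ler_sum => k _; exact: PM.
  by rewrite sumr_const card_ord mulr_natl.
have S1_le : normc (N%:R * P 0 - S1) <= N%:R * (e / 2).
  have -> : N%:R * P 0 - S1 = \sum_(k < N) (P 0 - P (polar s1 (0 + k%:R * (b / N%:R)))).
    by rewrite sumrB sumr_const card_ord mulr_natl.
  apply: le_trans (normc_sum _ _ _) _.
  apply: le_trans (_ : \sum_(k < N) (e / 2) <= _).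
    by apply: ler_sum => k _; rewrite normcBC Hd // subr0 normc_polar.
  by rewrite sumr_const card_ord mulr_natl.
have : normc (N%:R * P 0) <= N%:R * (e / 2) + (N%:R * (e / 2) + N%:R * M).
  have -> : N%:R * P 0 = (N%:R * P 0 - S1) + (S - (S - S1)) by ring.
  apply: le_trans (normcD _ _) (lerD S1_le _).
  apply: le_trans (normcB _ _) _; rewrite addrC; apply: lerD => //.
  by rewrite mulrC.
rewrite normcM.
have -> : normc (N%:R : C) = N%:R by rewrite -(rmorph_nat (real_complex R)) normc_real ger0_norm // ltW.
rewrite -!mulrDr ler_pM2l //; lra.
Qed.

(** By invariance, the maximum of |P| over one arc of angle 2 pi / m is its maximum over the whole
    circle of radius e^s, and so bounds |P 0|. *)
Lemma rotation_sample (P : C -> C) (s : R) m : s < 0 -> (0 < m)%N ->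
  (forall w, normc w < 1 -> cdiff P w) ->
  (forall w, P (polar 0 (2 * pi / m%:R) * w) = P w) ->
  exists2 r, 0 <= r <= 2 * pi / m%:R & normc (P 0) <= normc (P (polar s r)).
Proof.
move=> s0 m0 dP inv; pose T : R := 2 * pi / m%:R.
have T0 : 0 < T by rewrite divr_gt0 ?ltr0n // mulr_gt0 // pi_gt0.
have cont : continuous (fun t => normc (P (polar s t))).
  move=> t; apply/cvgrPdist_le => e e0.
  have [d d0 Hd] : exists2 d : R, 0 < d &
      forall v, normc (v - polar s t) < d -> normc (P v - P (polar s t)) <= e.
    by apply: cdiff_continuous e0; apply: dP; rewrite normc_polar expR_lt1.
  have Hc : {for t, continuous (fun t => expR s * (cos t : R))}.
    by apply: cvgM; [exact: cvg_cst|exact: continuous_cos].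
  have Hs : {for t, continuous (fun t => expR s * (sin t : R))}.
    by apply: cvgM; [exact: cvg_cst|exact: continuous_sin].
  have d20 : 0 < d / 2 by rewrite divr_gt0.
  move/cvgrPdist_lt : Hc => /(_ _ d20) Hc; move/cvgrPdist_lt : Hs => /(_ _ d20) Hs.
  near=> u.
  have hu : normc (P (polar s u) - P (polar s t)) <= e.
    apply: Hd; apply: le_lt_trans (normc_le_ReIm _) _ => /=.
    have h1 : `|expR s * cos t - expR s * cos u| < d / 2 by near: u.
    have h2 : `|expR s * sin t - expR s * sin u| < d / 2 by near: u.
    by rewrite distrC [X in _ + X]distrC (splitr d) ltrD.
  rewrite ler_norml; apply/andP; split.
    by have := normc_sub_le (P (polar s t)) (P (polar s u)); lra.
  by have := normc_sub_le (P (polar s u)) (P (polar s t)); rewrite normcBC; lra.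
have [r rT rmax] := EVT_max (ltW T0) (continuous_subspaceT cont).
exists r; first by move: rT; rewrite in_itv.
apply: (circle_bound_at0 s0 dP) => t t0.
(* Subtracting q full steps brings the angle t back into [0, T]. *)
pose q := Num.truncn (t / T).
have /andP[q1 q2] : q%:R <= t / T < q.+1%:R by rewrite truncn_itv // divr_ge0 // ltW.
have iter_inv n w : P (polar 0 (n%:R * T) * w) = P w.
  elim: n => [|n IH]; first by rewrite mul0r polar00 mul1r.
  by rewrite -natr1 mulrDl mul1r addrC -[in polar 0 _](addr0 0) polarD -mulrA inv.
have -> : P (polar s t) = P (polar s (t - q%:R * T)).
  rewrite -(iter_inv q (polar s (t - q%:R * T))) -polarD add0r; congr (P (polar _ _)); ring.
apply: rmax; rewrite in_itv /=; move: q1 q2.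
rewrite ler_pdivlMr // ltr_pdivrMr // -natr1 mulrDl mul1r => q1 q2.
by apply/andP; split; lra.
Unshelve. all: by end_near.
Qed.

End MaximumPrinciple.

(** * Moebius maps *)

Section Mobius.
Context {R : realType}.
Local Notation C := R[i].
Implicit Types a w z : C.

(** For |a| < 1 this is the automorphism of the disc that sends 0 to a; its inverse is
    [mobius (- a)]. *)
Definition mobius a w : C := (w + a) / (1 + conjc a * w).

Lemma mobius0r a : mobius a 0 = a.
Proof. by rewrite /mobius add0r mulr0 addr0 divr1. Qed.

Lemma mobius0l w : mobius 0 w = w.
Proof.
have -> : mobius 0 w = (w + 0) / (1 + conjc (0 : C) * w) by [].
by rewrite conjc0 mul0r !addr0 divr1.
Qed.

Lemma mobius_den_ge a w : normc w <= 1 -> 1 - normc a <= normc (1 + conjc a * w).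
Proof.
move=> w1; have := normc_sub_le (1 + conjc a * w) 1; rewrite normc1 opprD addrA subrr sub0r.
rewrite normc_opp normcM.
have -> : normc (conjc a) = normc a by case: a => x y /=; rewrite sqrrN.
have := normc_ge0 a; nra.
Qed.

Lemma mobius_den_neq0 a w : normc a < 1 -> normc w <= 1 -> 1 + conjc a * w != 0.
Proof.
move=> a1 /(mobius_den_ge a) h; rewrite -normc_eq0 gt_eqF //.
by apply: lt_le_trans h; rewrite subr_gt0.
Qed.

(** When |a| < 1, the sign of the right side is that of 1 - |w|^2; hence the Moebius map preserves
    the open disc, the closed disc and the circle. *)
Lemma mobius_identity a w : normc (1 + conjc a * w) ^+ 2 - normc (w + a) ^+ 2 =
  (1 - normc a ^+ 2) * (1 - normc w ^+ 2).
Proof. by rewrite !normc_sqr; case: a => x y; case: w => u v /=; ring. Qed.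

Lemma mobius_le1 a w : normc a < 1 -> normc w <= 1 -> normc (mobius a w) <= 1.
Proof.
move=> a1 w1; have d0 := mobius_den_neq0 a1 w1.
have a0 := normc_ge0 a; have w0 := normc_ge0 w.
rewrite normcM normcV ler_pdivrMr ?lt0r ?normc_eq0 ?d0 ?normc_ge0 // mul1r.
rewrite -(ler_pXn2r (ltn0Sn 1)) ?nnegrE ?normc_ge0 // -subr_ge0 mobius_identity.
by rewrite mulr_ge0 // subr_ge0 expr_le1 // ltW.
Qed.

Lemma mobius_lt1 a w : normc a < 1 -> normc w < 1 -> normc (mobius a w) < 1.
Proof.
move=> a1 w1; have d0 := mobius_den_neq0 a1 (ltW w1).
have a0 := normc_ge0 a; have w0 := normc_ge0 w.
rewrite normcM normcV ltr_pdivrMr ?lt0r ?normc_eq0 ?d0 ?normc_ge0 // mul1r.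
rewrite -(ltr_pXn2r (ltn0Sn 1)) ?nnegrE ?normc_ge0 // -subr_gt0 mobius_identity.
by rewrite mulr_gt0 // subr_gt0 expr_lt1.
Qed.

Lemma mobius_eq1 a w : normc a < 1 -> normc w = 1 -> normc (mobius a w) = 1.
Proof.
move=> a1 w1; have d0 : 1 + conjc a * w != 0 by rewrite mobius_den_neq0 // w1.
rewrite normcM normcV; suff -> : normc (w + a) = normc (1 + conjc a * w).
  by rewrite divff // normc_eq0.
apply/eqP; rewrite -(@eqrXn2 _ 2) ?normc_ge0 // eq_sym -subr_eq0 mobius_identity.
by rewrite w1 expr1n subrr mulr0.
Qed.

Lemma mobiusK a z : normc a < 1 -> normc z <= 1 -> mobius a (mobius (- a) z) = z.
Proof.
move=> a1 z1; have a1' : normc (- a) < 1 by rewrite normc_opp.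
have d1 := mobius_den_neq0 a1' z1.
have d2 := mobius_den_neq0 a1 (mobius_le1 a1' z1).
have a2 : 1 - conjc a * a != 0.
  have := mobius_den_neq0 a1 (_ : normc (- a) <= 1); rewrite normc_opp ltW // mulrN; exact.
have cN : conjc (- a) = - conjc a by exact: rmorphN.
move: d1 d2 a2; rewrite /mobius cN mulNr; move: (conjc a) => c d1 d2 a2; field.
rewrite d1 /=; apply: contra a2 => /eqP h; apply/eqP; rewrite -[RHS]h; ring.
Qed.

(** The difference factors as (w - z) (1 - |a|^2) over both denominators. Each denominator is at
    least 1 - |a|, and 1 - |a|^2 <= 2 (1 - |a|). *)
Lemma mobius_lipschitz a w z : normc a < 1 -> normc w <= 1 -> normc z <= 1 ->
  normc (mobius a w - mobius a z) <= 2 / (1 - normc a) * normc (w - z).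
Proof.
move=> a1 w1 z1; have d1 := mobius_den_neq0 a1 w1; have d2 := mobius_den_neq0 a1 z1.
have -> : mobius a w - mobius a z =
    (w - z) * (1 - conjc a * a) * (1 + conjc a * w)^-1 * (1 + conjc a * z)^-1.
  by rewrite /mobius; field; rewrite d1 d2.
rewrite !normcM !normcV; have a0 := normc_ge0 a.
set r := 1 - normc a; have r0 : 0 < r by rewrite subr_gt0.
have h1 : (normc (1 + conjc a * w))^-1 <= r^-1.
  by rewrite lef_pV2 ?posrE ?mobius_den_ge // (lt_le_trans r0) // mobius_den_ge.
have h2 : (normc (1 + conjc a * z))^-1 <= r^-1.
  by rewrite lef_pV2 ?posrE ?mobius_den_ge // (lt_le_trans r0) // mobius_den_ge.
have h3 : normc (1 - conjc a * a) <= 2 * r.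
  have -> : 1 - conjc a * a = (1 - normc a ^+ 2)%:C.
    apply/eqP; rewrite eq_complex normc_sqr; clear; case: a => x y /=.
    by apply/andP; split; apply/eqP; ring.
  by rewrite normc_real ger0_norm /r; nra.
have n0 := normc_ge0; have v0 z' : 0 <= (normc z')^-1 by rewrite invr_ge0 n0.
have -> : 2 / r * normc (w - z) = normc (w - z) * (2 * r) * r^-1 * r^-1.
  by field; rewrite gt_eqF.
by apply: ler_pM => //; [rewrite !mulr_ge0|apply: ler_pM => //; [rewrite mulr_ge0|apply: ler_pM]].
Qed.

Lemma derivable_cdiff (f : CC R -> CC R) w : derivable f w 1 -> cdiff f w.
Proof.
move=> /derivable_littleo H; exists ('D_1 f w) => e e0.
have [d /complex_gt0[r r0 ->] Hd] := H e%:C ltac:(by rewrite ltcR).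
exists r => // v vr; rewrite -lecR rmorphM /= -!norm_normc.
have := Hd (v - w); rewrite subrKC; apply.
by rewrite norm_normc ltcR.
Qed.

Lemma derivable_mobius a (b w : CC R) : normc a < 1 -> normc (b * w) <= 1 ->
  derivable ((fun w => mobius a (b * w)) : CC R -> CC R) w 1.
Proof.
move=> a1 w1; have db : derivable (fun w : CC R => (b * w : CC R)) w 1.
  by apply: derivableM; [exact: derivable_cst|exact: derivable_id].
have n0 : 1 + conjc a * (b * w) != 0 by exact: mobius_den_neq0.
pose n : CC R -> CC R := fun w => b * w + a.
pose d : CC R -> CC R := fun w => 1 + conjc a * (b * w).
have dn : derivable n w 1.
  exact: (@derivableD _ _ _ (fun w : CC R => (b * w : CC R)) (cst (a : CC R)) w 1 db (derivable_cst _ _ _)).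
have dd1 : derivable (fun w : CC R => (conjc a * (b * w) : CC R)) w 1.
  exact: (@derivableM _ _ (cst (conjc a : CC R)) (fun w : CC R => (b * w : CC R)) w 1 (derivable_cst _ _ _) db).
have dd : derivable d w 1.
  exact: (@derivableD _ _ _ (cst (1 : CC R)) (fun w : CC R => (conjc a * (b * w) : CC R)) w 1 (derivable_cst _ _ _) dd1).
have dv := @derivableV _ _ d w 1 n0 dd.
exact: (@derivableM _ _ n _ w 1 dn dv).
Qed.

(* Apply the maximum principle to the product over k of
   g (mobius a (omega^k * w)), omega a primitive m-th root of unity. *)
Lemma mobius_sample (g : CC R -> CC R) a (s : R) m : s < 0 -> normc a < 1 -> (0 < m)%N ->
  (forall w, normc w < 1 -> derivable g w 1) ->
  exists2 r, 0 <= r <= 2 * pi / m%:R &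
    normc (g a) ^+ m <=
      \prod_(0 <= k < m) normc (g (mobius a (polar s (r + k%:R * (2 * pi / m%:R))))).
Proof.
move=> s0 a1 m0 dg; pose T : R := 2 * pi / m%:R.
pose F (k : nat) (w : CC R) : CC R := g (mobius a (polar 0 (k%:R * T) * w)).
pose P (w : CC R) : CC R := \prod_(0 <= k < m) F k w.
have dF k w : normc w < 1 -> derivable (F k) w 1.
  move=> w1; have pw : normc (polar 0 (k%:R * T) * w) < 1.
    by rewrite normcM normc_polar expR0 mul1r.
  apply/derivable1_diffP; apply: (@differentiable_comp _ _ _ _ _ g).
    by apply/derivable1_diffP; apply: derivable_mobius => //; exact: ltW.
  by apply/derivable1_diffP; apply: dg; exact: mobius_lt1.
have dP w : normc w < 1 -> cdiff P w.
  move=> w1; apply: derivable_cdiff; rewrite /P /index_iota.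
  elim: (iota 0 (m - 0)) => [|k l IH].
    by rewrite (_ : (fun _ => _) = cst 1); [exact: derivable_cst|apply/funext => v; rewrite big_nil].
  rewrite (_ : (fun _ => _) = (fun v => F k v * \prod_(j <- l) F j v)); last by apply/funext => v; rewrite big_cons.
  exact: (@derivableM _ _ (F k) (fun v => \prod_(j <- l) F j v) w 1 (dF k w w1) IH).
have shift k w : F k (polar 0 T * w) = F k.+1 w.
  by rewrite /F mulrA -polarD addr0 -natr1 mulrDl mul1r.
(* The rotation shifts the factors by one index; the factor that leaves at index m has made a full
   turn and equals the one at index 0. *)
have inv w : P (polar 0 T * w) = P w.
  rewrite /P (eq_bigr _ (fun k _ => shift k w)).
  case: m m0 @T @F @P dF dP shift => // m _ T F P dF dP shift.
  rewrite big_nat_recr //= [RHS]big_nat_recl //= mulrC; congr (_ * _).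
  rewrite /F mul0r; congr (g (mobius a (_ * w))).
  have -> : m.+1%:R * T = 0 + 2 * pi by rewrite /T add0r mulrC divfK // pnatr_eq0.
  exact: polar_2pi.
have [r rT H] := rotation_sample s0 m0 dP inv.
exists r => //; move: H; rewrite /P.
rewrite (eq_bigr (fun=> g a)); last by move=> k _; rewrite /F mulr0 mobius0r.
rewrite prodr_const_nat subn0 normcX normc_prod => H; apply: le_trans H _.
rewrite le_eqVlt; apply/orP; left; apply/eqP; apply: eq_bigr => k _.
by rewrite /F -polarD add0r [_ + r]addrC.
Qed.

End Mobius.

(** * Arcs of the circle and their measure *)

Section Arcs.
Context {R : realType}.
Local Notation C := R[i].
Implicit Types (t u x : R).

(** The squares of both sides equal 2 - 2 cos (t - u). *)
Lemma chord_length t u : normc (polar 0 t - polar 0 u) = 2 * `|sin ((t - u) / 2)|.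
Proof.
apply/eqP; rewrite -(@eqrXn2 _ 2) ?normc_ge0 ?mulr_ge0 //; apply/eqP.
rewrite normc_sqr exprMn real_normK ?num_real // /polar expR0 /= !mul1r.
have h : cos (t - u) = 1 - 2 * sin ((t - u) / 2) ^+ 2.
  rewrite {1}(_ : t - u = ((t - u) / 2) *+ 2); last by rewrite -mulr_natr divfK.
  by rewrite cos_mulr2n cos2sin2; ring.
have := cos2Dsin2 t; have := cos2Dsin2 u; move: h; rewrite cosB; nra.
Qed.

Lemma sin_mvt x : 0 < x -> exists2 c, 0 < c < x & sin x = cos c * x.
Proof.
move=> x0; have [|c] := @MVT R sin cos 0 x x0.
  by apply: continuous_subspaceT => y; exact: continuous_sin.
by rewrite in_itv /= sin0 !subr0 => c0 ->; exists c.
Qed.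

Lemma normr_sin_le x : `|sin x| <= `|x|.
Proof.
wlog x0 : x / 0 < x => [H|].
  have [x0|x0|->] := ltgtP x 0; [|exact: H|by rewrite sin0 !normr0].
  by rewrite -normrN -sinN -[leRHS]normrN H // oppr_gt0.
have [c _ ->] := sin_mvt x0; rewrite normrM ler_piMl //; exact: cos_max.
Qed.

(** With y = x / 2, sin x = 2 sin y cos y and sin y = y cos c for some c < y, so sin x >= 2 y (cos
    y)^2; and 2 (cos y)^2 = 1 + cos x >= 1. *)
Lemma sin_ge_half x : 0 <= x <= pi / 2 -> x / 2 <= sin x.
Proof.
move=> /andP[]; rewrite le_eqVlt => /predU1P[<-|x0] xpi; first by rewrite sin0 mul0r.
have p0 : 0 < (pi : R) := pi_gt0 _.
set y := x / 2; have y0 : 0 < y by rewrite divr_gt0.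
have xy : x = y *+ 2 by rewrite -mulr_natr divfK.
have [c /andP[c0 cy] sy] := sin_mvt y0.
have hy : 0 <= cos y by apply: cos_ge0_pihalf; apply/andP; split; rewrite /y; lra.
have hcy : cos y <= cos c.
  by apply: ltW; rewrite ltr_cos // in_itv /=; apply/andP; split; rewrite /y in cy *; lra.
have cx : 0 <= cos x by apply: cos_ge0_pihalf; apply/andP; split; lra.
have c2 : cos y * cos y >= 1 / 2.
  by move: cx; rewrite xy cos_mulr2n expr2 -mulr_natr; lra.
have -> : sin x = 2 * cos c * cos y * y by rewrite xy sin_mulr2n sy -mulr_natr; ring.
apply: (@le_trans _ _ (2 * cos y * cos y * y)).
  by rewrite ler_peMl ?(ltW y0) //; lra.
rewrite ler_wpM2r ?(ltW y0) // ler_wpM2r //; lra.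
Qed.

Lemma polar_dist s t u : s <= 0 ->
  normc (polar s t - polar 0 u) <= (1 - expR s) + 2 * `|t - u|.
Proof.
move=> s0; have -> : polar s t - polar 0 u =
    (expR s - 1)%:C * polar 0 t + (polar 0 t - polar 0 u).
  rewrite /polar expR0; apply/eqP; rewrite eq_complex /=.
  by apply/andP; split; apply/eqP; ring.
apply: le_trans (normcD _ _) _; rewrite normcM normc_real normc_polar expR0 mulr1.
rewrite chord_length lerD //.
  by rewrite ler0_norm ?opprB // subr_le0 expR_le1.
rewrite ler_wpM2l //; apply: le_trans (normr_sin_le _) _.
by rewrite normrM ler_piMr // ger0_norm ?invr_ge0 // invf_le1 // ler1n.
Qed.

Lemma lipschitz_continuousC (f : R -> CC R) (L : R) :
  (forall t u, normc (f t - f u) <= L * `|t - u|) -> continuous f.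
Proof.
move=> H t; apply/cvgrPdist_le => e /complex_gt0[r r0 ->].
have L0 : 0 <= L by have := le_trans (normc_ge0 _) (H 1 0); rewrite subr0 normr1 mulr1.
have L1 : 0 < L + 1 by rewrite ltr_wpDl.
near=> u; rewrite norm_normc lecR; apply: le_trans (H _ _) _.
apply: (@le_trans _ _ ((L + 1) * `|t - u|)); first by rewrite ler_wpM2r // lerDl.
rewrite mulrC -ler_pdivlMr //; near: u.
by apply: cvgr_dist_le; [exact: cvg_id|exact: divr_gt0].
Unshelve. all: by end_near.
Qed.

(** The angle is acos x on the closed upper half circle and 2 pi - acos x below it. *)
Lemma polar_surj (z : C) : normc z = 1 -> exists2 t, 0 <= t < 2 * pi & z = polar 0 t.
Proof.
move=> z1; have := normc_sqr z; rewrite z1 expr1n; case: z z1 => x y _ /= xy.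
have p0 : 0 < (pi : R) := pi_gt0 _.
have x1 : -1 <= x <= 1 by rewrite -ler_norml -(@expr_le1 _ 2) ?real_normK ?num_real //; nra.
have xE : cos (acos x) = x by apply: acosK; rewrite in_itv.
have sE : sin (acos x) = `|y|.
  by rewrite sin_acos // -sqrtr_sqr; congr Num.sqrt; rewrite xy; ring.
have a0 := acos_ge0 x1; have api := acos_lepi x1.
rewrite /polar expR0; have [y0|y0] := leP 0 y.
  exists (acos x); first by apply/andP; split => //; lra.
  by rewrite !mul1r xE sE ger0_norm.
(* This makes 2 pi - acos x strictly less than 2 pi. *)
have a1 : 0 < acos x.
  rewrite lt_neqAle a0 andbT eq_sym; apply/eqP => h.
  by move: sE; rewrite h sin0 => /esym/eqP; rewrite normr_eq0 lt_eqF.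
exists (2 * pi - acos x); first by apply/andP; split; lra.
rewrite !mul1r [2 * pi]mulr_natl addrC cosD2pi sinD2pi cosN sinN xE sE.
by rewrite ltr0_norm ?opprK.
Qed.

(** The arcs are closed and overlap at endpoints: closedness gives measurability, and only covering
    and upper bounds on measure are needed. *)
Definition mobius_arc (a : C) m k : set (CC R) :=
  [set mobius a (polar 0 t) | t in `[k%:R * (2 * pi / m%:R), k.+1%:R * (2 * pi / m%:R)]].

Variables (a : C) (m : nat).
Hypotheses (a1 : normc a < 1) (m0 : (0 < m)%N).

Let T : R := 2 * pi / m%:R.

Let T0 : 0 < T.
Proof. by rewrite divr_gt0 ?ltr0n // mulr_gt0 // pi_gt0. Qed.

Let n1a : 0 < 1 - normc a.
Proof. by rewrite subr_gt0. Qed.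

Lemma mobius_polar_dist s t u : s <= 0 ->
  normc (mobius a (polar s t) - mobius a (polar 0 u)) <=
  2 / (1 - normc a) * ((1 - expR s) + 2 * `|t - u|).
Proof.
move=> s0; apply: le_trans (mobius_lipschitz a1 _ _) _; rewrite ?normc_polar ?expR0 ?expR_le1 //.
by rewrite ler_wpM2l ?polar_dist // divr_ge0 // ltW.
Qed.

Lemma closed_arc k : closed (mobius_arc a m k).
Proof.
apply: compact_closed; first exact: norm_hausdorff.
apply: continuous_compact; last exact: segment_compact.
apply: continuous_subspaceT; apply: (@lipschitz_continuousC _ (2 / (1 - normc a) * 2)) => t u.
apply: le_trans (mobius_polar_dist _ _ (lexx _)) _.
by rewrite expR0 subrr add0r mulrA.
Qed.

(** Pulling z back by [mobius (- a)] gives an angle in [0, 2 pi), whose quotient by T is truncated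
    to find the arc. *)
Lemma arc_cover z : normc z = 1 -> exists2 k, (k < m)%N & mobius_arc a m k z.
Proof.
move=> z1; have na1 : normc (- a) < 1 by rewrite normc_opp.
have [t /andP[t0 t2pi] tE] := polar_surj (mobius_eq1 na1 z1).
pose k := Num.truncn (t / T).
have /andP[k1 k2] : k%:R <= t / T < k.+1%:R by rewrite truncn_itv // divr_ge0 // ltW.
exists k.
  rewrite -(ltr_nat R); apply: le_lt_trans k1 _.
  by rewrite ltr_pdivrMr // /T mulrC divfK // pnatr_eq0 -lt0n.
exists t; last by rewrite -tE mobiusK // z1.
rewrite /= in_itv /= -/T; apply/andP; split; first by rewrite -ler_pdivlMr.
by rewrite -ler_pdivrMr // ltW.
Qed.

Lemma arc_diam k z w : mobius_arc a m k z -> mobius_arc a m k w ->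
  normc (z - w) <= 2 / (1 - normc a) * (2 * T).
Proof.
move=> [t + <-] [u + <-]; rewrite /= !in_itv /= -/T -natr1 mulrDl mul1r => /andP[t1 t2] /andP[u1 u2].
apply: le_trans (mobius_polar_dist _ _ (lexx _)) _.
rewrite expR0 subrr add0r ler_wpM2l ?divr_ge0 ?(ltW n1a) // ler_wpM2l //.
by rewrite ler_norml; apply/andP; split; lra.
Qed.

End Arcs.

Section HaarBounds.
Context {R : realType}.
Implicit Types A : set (CC R).

Lemma closed_angles_measurable A : closed A -> measurable (angles R A : set (measurableTypeR R)).
Proof.
move=> cA; apply: measurableI.
  rewrite (_ : [set t : R | _] = `[0, 2 * pi[%classic); first exact: measurable_itv.
  by apply/seteqP; split => t /=; rewrite in_itv.
apply: closed_measurable.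
have ct : continuous (fun t : R => ((cos t +i* sin t)%C : CC R)).
  apply: (@lipschitz_continuousC _ _ 2) => t u.
  have := @polar_dist _ 0 t u (lexx _).
  by rewrite /polar expR0 !mul1r subrr add0r.
by move/continuous_closedP : ct; apply.
Qed.

Lemma haarT_le A (B : set (measurableTypeR R)) (y : R) : closed A -> measurable B ->
  angles R A `<=` B -> (lebesgue_measure B <= y%:E)%E -> (haarT R A <= (y / (2 * pi))%:E)%E.
Proof.
move=> cA mB AB By; have p0 : 0 < 2 * pi :> R by rewrite mulr_gt0 // pi_gt0.
rewrite /haarT EFinM lee_wpmul2r ?lee_fin ?invr_ge0 ?(ltW p0) //.
apply: le_trans By; apply: le_measure => //; rewrite inE //.
exact: closed_angles_measurable.
Qed.

Lemma haarT_ge0 A : (0 <= haarT R A)%E.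
Proof.
by rewrite /haarT mule_ge0 // lee_fin invr_ge0 mulr_ge0 // pi_ge0.
Qed.

Lemma lebesgue_segment_le (x y : R) : x <= y -> (lebesgue_measure `[x, y]%classic <= (y - x)%:E)%E.
Proof.
move=> xy; rewrite lebesgue_measure_itv /=; case: ifP => //= _.
by rewrite lee_fin subr_ge0.
Qed.

(** Fix one angle t0 of A. A chord of length at most d forces every other angle to be within 2 d of
    t0 modulo 2 pi, since sin x >= x / 2. *)
Lemma haarT_diam A (d : R) : closed A -> 0 <= d ->
  (forall z w, A z -> A w -> normc (z - w) <= d) ->
  (haarT R A <= (8 * d / (2 * pi))%:E)%E.
Proof.
move=> cA d0 dA; have p0 : 0 < pi :> R := pi_gt0 _.
have [A0|/set0P[t0 [/andP[t00 t02] At0]]] := eqVneq (angles R A) set0.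
  apply: (@haarT_le A set0) => //; first by rewrite A0.
  by rewrite measure0 lee_fin mulr_ge0.
(* [B2] and [B3] catch the angles that are close to t0 across the cut at 0. The total length is 4 d
   + 2 d + 2 d. *)
pose B1 : set R := `[t0 - 2 * d, t0 + 2 * d]%classic.
pose B2 : set R := `[t0 + 2 * pi - 2 * d, t0 + 2 * pi]%classic.
pose B3 : set R := `[t0 - 2 * pi, t0 - 2 * pi + 2 * d]%classic.
have m1 : measurable (B1 : set (measurableTypeR R)) by exact: measurable_itv.
have m2 : measurable (B2 : set (measurableTypeR R)) by exact: measurable_itv.
have m3 : measurable (B3 : set (measurableTypeR R)) by exact: measurable_itv.
apply: (@haarT_le A (B1 `|` B2 `|` B3)) => //.
- by apply: measurableU => //; exact: measurableU.
- move=> t [/andP[u0 u2] At]; have := dA _ _ At At0.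
  have pE u : (cos u +i* sin u)%C = polar 0 u :> R[i] by rewrite /polar expR0 !mul1r.
  rewrite !pE chord_length => h; set x := `|(t - t0) / 2|.
  have sx : `|sin ((t - t0) / 2)| = `|sin x|.
    by rewrite /x; case: (ger0P ((t - t0) / 2)) => _; rewrite ?sinN ?normrN.
  have x0 : 0 <= x by exact: normr_ge0.
  have xpi : x < pi by rewrite /x ltr_norml; apply/andP; split; lra.
  have [xh|xh] := leP x (pi / 2).
    have := sin_ge_half (_ : 0 <= x <= pi / 2); rewrite x0 xh => /(_ isT) hs.
    left; left; rewrite /B1 /= in_itv /=.
    have : x <= d by move: h; rewrite sx; have := ler_norm (sin x); lra.
    by rewrite /x ler_norml => /andP[? ?]; apply/andP; split; lra.
  have := sin_ge_half (_ : 0 <= pi - x <= pi / 2).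
  have -> : 0 <= pi - x <= pi / 2 by apply/andP; split; lra.
  have -> : sin (pi - x) = sin x by rewrite sinB sinpi cospi; ring.
  move=> /(_ isT) hs; have hx : pi - x <= d.
    by move: h; rewrite sx; have := ler_norm (sin x); lra.
  have [tt|tt] := leP t0 t.
    have xE : x = (t - t0) / 2 by rewrite /x ger0_norm //; lra.
    by left; right; rewrite /B2 /= in_itv /=; apply/andP; split; lra.
  have xE : x = (t0 - t) / 2 by rewrite /x ler0_norm; lra.
  by right; rewrite /B3 /= in_itv /=; apply/andP; split; lra.
- apply: le_trans (measureU2 _ _ _) _ => //; first exact: measurableU.
  apply: (@le_trans _ _ ((4 * d)%:E + (2 * d)%:E + (2 * d)%:E)%E).
    apply: leeD; last first.
      by apply: le_trans (lebesgue_segment_le _) _; rewrite ?lee_fin; lra.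
    apply: le_trans (measureU2 _ _ _) _ => //.
    by apply: leeD; apply: le_trans (lebesgue_segment_le _) _; rewrite ?lee_fin; lra.
  by rewrite -!EFinD lee_fin; lra.
Qed.

Lemma haarT_arc (a : R[i]) m k : normc a < 1 -> (0 < m)%N ->
  (haarT R (mobius_arc a m k) <= (32 / (1 - normc a) / m%:R)%:E)%E.
Proof.
move=> a1 m0; have p0 : 0 < pi :> R := pi_gt0 _.
have n1a : 0 < 1 - normc a by rewrite subr_gt0.
have m0' : 0 < m%:R :> R by rewrite ltr0n.
pose d := 2 / (1 - normc a) * (2 * (2 * pi / m%:R)).
have d0 : 0 <= d by rewrite mulr_ge0 ?divr_ge0 // ?mulr_ge0 ?divr_ge0 // ltW // mulr_gt0.
have cA : closed (mobius_arc a m k) by exact: closed_arc.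
have -> : 32 / (1 - normc a) / m%:R = 8 * d / (2 * pi).
  by rewrite /d; move: (pi : R) p0 => p p0; field; rewrite !gt_eqF.
by apply: haarT_diam => // z w; exact: arc_diam.
Qed.

(** The constant has to be exactly 1 here: it is raised to the number of coordinates at which the
    centre is 0, which is not bounded in advance. *)
Lemma haarT_arc0 m k : (k < m)%N -> (haarT R (mobius_arc (0 : R[i])%R m k) <= (1 / m%:R)%:E)%E.
Proof.
move=> km; have m0 : (0 < m)%N by exact: leq_ltn_trans km.
have p0 : 0 < pi :> R := pi_gt0 _.
have m0' : 0 < m%:R :> R by rewrite ltr0n.
set T : R := 2 * pi / m%:R; have T0 : 0 < T by rewrite divr_gt0 // mulr_gt0.
have n01 : normc (0 : R[i]) < 1 by rewrite normc0.
pose B : set R := `[k%:R * T, k.+1%:R * T]%classic.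
have mB : measurable (B : set (measurableTypeR R)) by exact: measurable_itv.
have -> : 1 / m%:R = T / (2 * pi).
  by rewrite /T; move: (pi : R) p0 => p p0; field; rewrite !gt_eqF.
(* The last arc ends at the angle 2 pi, which [angles] records as 0; hence the extra null set. *)
apply: (@haarT_le _ (B `|` [set 0])); first exact: closed_arc.
- exact: measurableU.
- move=> t [/andP[t0 t2] [u uB]]; rewrite mobius0l.
  have -> : (cos t +i* sin t)%C = polar 0 t :> R[i] by rewrite /polar expR0 !mul1r.
  move=> ut; have : 2 * `|sin ((u - t) / 2)| = 0.
    by rewrite -chord_length ut subrr normc0.
  move/eqP; rewrite mulf_eq0 pnatr_eq0 /= normr_eq0 => /eqP s0.
  have hx : 0 < `|(u - t) / 2| < pi -> False.
    move=> /sin_gt0_pi; by case: (ger0P ((u - t) / 2)) => _; rewrite ?sinN s0 ?oppr0 ltxx.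
  have uB' := uB; move: uB'; rewrite /= in_itv /= -/T => /andP[u1 u2].
  have u0 : 0 <= u by apply: le_trans u1; rewrite mulr_ge0 // ltW.
  have u2pi : u <= 2 * pi.
    apply: le_trans u2 _; apply: (@le_trans _ _ (m%:R * T)).
      by rewrite ler_wpM2r ?(ltW T0) // ler_nat.
    by rewrite /T mulrC divfK // gt_eqF.
  have [->|tu] := eqVneq t u; first by left.
  right => /=; have [//|tn0] := eqVneq t 0; exfalso; apply: hx.
  have tp : 0 < t by rewrite lt0r tn0.
  have ut0 : (u - t) / 2 != 0 by rewrite mulf_neq0 // subr_eq0 eq_sym.
  by rewrite normr_gt0 ut0 ltr_norml; apply/andP; split; lra.
- apply: le_trans (measureU2 _ _ _) _ => //.
  apply: (@le_trans _ _ (T%:E + 0%:E)%E); last by rewrite -EFinD addr0.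
  apply: leeD; last by rewrite le_eqVlt; apply/orP; left; apply/eqP; exact: (@lebesgue_measure_set1 R 0).
  apply: le_trans (lebesgue_segment_le _) _; first by rewrite ler_wpM2r ?(ltW T0) // ler_nat.
  by rewrite lee_fin -natr1; lra.
Qed.

End HaarBounds.

Lemma closed_borel (T : topologicalType) (A : set T) : closed A -> <<s open >> A.
Proof.
move=> cA; have [_ hC _] := smallest_sigma_algebra setT (@open T).
rewrite -(setCK A) -setTD; apply: hC; apply: sub_sigma_algebra.
exact: closed_openC.
Qed.

(** * Sampling on products of arcs *)

Section ProductSampling.
Context {R : realType} {I : Type}.
Variable m : nat.
Hypothesis m0 : (0 < m)%N.

Fixpoint multi_indices n : seq (seq nat) :=
  if n is n'.+1 then [seq k :: l | k <- index_iota 0 m, l <- multi_indices n'] else [:: [::]].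

Lemma size_multi_indices n : size (multi_indices n) = (m ^ n)%N.
Proof. by elim: n => //= n IH; rewrite size_allpairs IH size_iota subn0 expnS. Qed.

Lemma mem_multi_indices (l : seq nat) : all (ltn^~ m) l -> l \in multi_indices (size l).
Proof.
elim: l => //= k l IH /andP[km lm]; apply/allpairsP; exists (k, l) => /=.
by split; [rewrite mem_index_iota|exact: IH|].
Qed.

Lemma multi_indices_lt n l j : l \in multi_indices n -> (nth 0%N l j < m)%N.
Proof.
elim: n l j => [|n IH] l j /=; first by rewrite inE => /eqP ->; rewrite nth_nil.
move=> /allpairsP[[k l'] /= [+ l'n ->]]; rewrite mem_index_iota.
by case: j => [|j] //= _; exact: IH.
Qed.

Implicit Types (z b c : CI I R) (s : seq {classic I}).

(* The entries of [l] are the arc indices of the coordinates, in the order of [s]. *)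
Definition cell s c (l : seq nat) : set (CI I R) :=
  [set z | forall i, Stdlib.Lists.List.In i s ->
     mobius_arc (c i) m (nth 0%N l (index (i : {classic I}) s)) (z i)].

(** Links [List.In], used by [product_haar], to the boolean membership that [{classic I}] provides
    for a bare type. *)
Lemma In_mem s (i : I) : Stdlib.Lists.List.In i s <-> (i : {classic I}) \in s.
Proof.
elim: s => //= j s IH; rewrite inE; split.
  by case=> [->|/IH ->]; rewrite ?eqxx ?orbT.
by case/predU1P => [->|/IH]; [left|right].
Qed.

Lemma NoDup_uniq s : uniq s -> Stdlib.Lists.List.NoDup s.
Proof.
elim: s => [_|j s IH /= /andP[js us]]; first exact: Stdlib.Lists.List.NoDup_nil.
by apply: Stdlib.Lists.List.NoDup_cons; [move/In_mem; apply/negP|exact: IH].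
Qed.

Lemma cell_cover s c z : (forall i, normc (c i) < 1) -> (forall i, normc (z i) = 1) ->
  exists2 l, l \in multi_indices (size s) & cell s c l z.
Proof.
move=> c1 z1.
have /choice[K HK] : forall i, exists k, (k < m)%N /\ mobius_arc (c i) m k (z i).
  by move=> i; have [k km zk] := arc_cover (c1 i) m0 (z1 i); exists k.
exists (map K s).
  rewrite -(size_map K s); apply: mem_multi_indices.
  by rewrite all_map; apply/(@allP {classic I} _ s) => i _ /=; exact: (HK i).1.
by move=> i /In_mem si; rewrite (nth_map i) ?index_mem // nth_index //; exact: (HK i).2.
Qed.

Lemma updE z (i j : I) w : upd I R z j w i = if pselect (i = j) then w else z i.
Proof. by []. Qed.

Lemma upd_same z (j : I) w : upd I R z j w j = w.
Proof. by rewrite updE; case: pselect. Qed.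

Lemma upd_other z (i j : I) w : i <> j -> upd I R z j w i = z i.
Proof. by move=> ij; rewrite updE; case: pselect. Qed.

Lemma upd_id z (j : I) : upd I R z j (z j) = z.
Proof. by apply/funext => i; rewrite updE; case: pselect => //= ->. Qed.

(** Induction on s: the one-variable sampling in the first coordinate gives m values, and the
    induction hypothesis applies to each. The base point b is separate from c because coordinates
    already treated hold sampled values. The radius e^sg < 1 keeps all samples in the open
    polydisc. *)
Lemma product_sample (h : CI I R -> CC R) (sg : R) c s b : sg < 0 ->
  (forall i, normc (c i) < 1) ->
  (forall (i : I) z w, (forall j, normc (z j) <= 1) -> normc w < 1 ->
     derivable (fun w : CC R => h (upd I R z i w)) w 1) ->
  uniq s -> (forall i, normc (b i) < 1) -> (forall i, i \in s -> b i = c i) ->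
  exists p : seq nat -> CI I R,
    [/\ forall l i, normc (p l i) < 1,
        forall l i, i \notin s -> p l i = b i,
        forall l i, i \in s -> exists2 t : R, p l i = mobius (c i) (polar sg t) &
          (nth 0%N l (index i s))%:R * (2 * pi / m%:R) <= t <=
          (nth 0%N l (index i s)).+1%:R * (2 * pi / m%:R)
      & normc (h b) ^+ (m ^ size s) <= \prod_(l <- multi_indices (size s)) normc (h (p l))].
Proof.
move=> sg0 c1 dh; elim: s b => [|j s IH] b /=.
  move=> _ b1 _; exists (fun=> b); split => //.
  by rewrite big_seq1 expn0 expr1.
move=> /andP[js us] b1 bc.
have bj : b j = c j by apply: bc; rewrite inE eqxx.
have [r /andP[r0 rT] Hr] := mobius_sample (g := fun w => h (upd I R b j w)) sg0 (c1 j) m0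
  (fun w w1 => dh j b w (fun i => ltW (b1 i)) w1).
pose q k := mobius (c j) (polar sg (r + k%:R * (2 * pi / m%:R))).
have q1 k : normc (q k) < 1 by apply: mobius_lt1 => //; rewrite normc_polar expR_lt1.
have b'1 k i : normc (upd I R b j (q k) i) < 1.
  by rewrite updE; case: pselect => //= *; exact: b1.
have b'c k i : i \in s -> upd I R b j (q k) i = c i.
  move=> si; rewrite upd_other; first by apply: bc; rewrite inE si orbT.
  by move=> ij; move: js; rewrite -ij si.
have /choice[p Hp] := fun k => IH (upd I R b j (q k)) us (b'1 k) (b'c k).
(* The head of l selects the sample in coordinate j; the tail indexes the remaining coordinates. *)
exists (fun l => p (head 0%N l) (behead l)); split.
- by move=> l i; case: (Hp (head 0%N l)) => H1 H2 H3 H4; exact: H1.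
- move=> l i; rewrite inE negb_or => /andP[ij si].
  have [_ -> // _ _] := Hp (head 0%N l).
  by move/eqP: ij => ij; rewrite upd_other.
- move=> l i; rewrite inE eq_sym; have [<- _|ij /= si] := eqVneq j i.
    exists (r + (nth 0%N l 0)%:R * (2 * pi / m%:R)).
      have [_ -> // _ _] := Hp (head 0%N l).
      by rewrite upd_same nth0.
    by rewrite -natr1 mulrDl mul1r; apply/andP; split; lra.
  have [_ _ /(_ (behead l) i si)[t tE tT] _] := Hp (head 0%N l).
  by exists t => //; move: tT; rewrite nth_behead.
- rewrite big_allpairs_dep /= expnS exprM.
  move: Hr; rewrite -bj upd_id => Hr.
  apply: le_trans (_ : (\prod_(0 <= k < m) normc (h (upd I R b j (q k)))) ^+ (m ^ size s) <= _).
    apply: lerXn2r; rewrite ?nnegrE ?exprn_ge0 ?normc_ge0 //.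
      by apply: prodr_ge0 => k _; exact: normc_ge0.
    by rewrite /q -bj.
  rewrite -prodrXl; apply: ler_prod => k _.
  rewrite exprn_ge0 ?normc_ge0 //=.
  by have [_ _ _] := Hp k.
Qed.

End ProductSampling.

(** * Topology of the polydisc *)

Section PolydiscTopology.
Context {R : realType} {I : Type}.
Implicit Types (z y : CI I R) (s : seq {classic I}).

Definition close s (d : R) z y := forall i : {classic I}, i \in s -> normc (y i - z i) < d.

(** The sets containing some [close s d z] form a filter; its convergence to z in the product
    topology need only be checked one coordinate at a time. *)
Lemma nbhs_close z (U : set (CI I R)) : nbhs z U ->
  exists s, exists2 d : R, 0 < d & close s d z `<=` U.
Proof.
pose F := [set U : set (CI I R) | exists s, exists2 d : R, 0 < d & close s d z `<=` U].
have FF : Filter F.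
  split.
  - by exists [::], 1.
  - move=> P Q [s [d d0 sP]] [t [e e0 tQ]]; exists (s ++ t), (Num.min d e).
      by rewrite lt_min d0.
    move=> y H; split; [apply: sP|apply: tQ] => i si.
      by have := H i; rewrite mem_cat si lt_min => /(_ isT)/andP[].
    by have := H i; rewrite mem_cat si orbT lt_min => /(_ isT)/andP[].
  - by move=> P Q PQ [s [d d0 sP]]; exists s, d => // y /sP /PQ.
suff : F `=>` nbhs z by apply.
apply/cvg_sup => i; apply/cvg_image.
  by rewrite eqEsubset; split => // w _; exists (fun=> w).
move=> A /nbhs_ballP[e /complex_gt0[r r0 ->] HA].
exists ((fun y : CI I R => y i) @^-1` A).
  exists [:: (i : {classic I})], r => // y /(_ i); rewrite mem_seq1 eqxx => /(_ isT) H.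
  by apply: HA; rewrite /ball /= norm_normc ltcR normcBC.
by apply: image_preimage; rewrite eqEsubset; split => // w _; exists (fun=> w).
Qed.

Lemma close_nbhs z s (d : R) : 0 < d -> nbhs z (close s d z).
Proof.
move=> d0; elim: s => [|i s IH]; first by apply: filterS filterT.
have zi : nbhs z [set y : CI I R | normc (y i - z i) < d].
  have dC : 0 < d%:C by rewrite ltcR.
  have H : nbhs (z i : CC R) [set w | normc (w - z i) < d].
    by apply/nbhs_ballP; exists d%:C => // w; rewrite /ball /= norm_normc ltcR normcBC.
  exact: (@proj_continuous {classic I} (fun=> CC R) i z _ H).
by apply: filterS (filterI zi IH) => y [/= yi ys] j; rewrite inE => /predU1P[->|/ys].
Qed.

Lemma within_closeP (A : set (CI I R)) (f : CI I R -> CC R) :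
  {within A, continuous f} -> forall z, A z -> forall e : R, 0 < e ->
  exists s, exists2 d : R, 0 < d &
    forall y, A y -> close s d z y -> normc (f y - f z) <= e.
Proof.
move=> /subspace_continuousP fc z Az e e0.
have /cvgrPdist_le /(_ e%:C) := fc z Az; rewrite ltcR => /(_ e0).
rewrite /within /= => /nbhs_close[s [d d0 H]]; exists s, d => // y Ay /H /(_ Ay).
by rewrite norm_normc lecR normcBC.
Qed.

(** The disc is a closed subset of the continuous image of a real square. *)
Lemma compact_disc : compact [set w : CC R | `|w| <= 1].
Proof.
pose f (p : R * R) : CC R := p.1 +i* p.2.
have fc : continuous f.
  move=> p; apply/cvgrPdist_lt => e /complex_gt0[r r0 ->].
  have r20 : 0 < r / 2 by rewrite divr_gt0.
  near=> q; rewrite norm_normc ltcR; apply: le_lt_trans (normc_le_ReIm _) _ => /=.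
  rewrite (splitr r); apply: ltrD; near: q.
    by move: (r / 2) r20; apply/cvgrPdist_lt; exact: cvg_fst.
  by move: (r / 2) r20; apply/cvgrPdist_lt; exact: cvg_snd.
apply: (@subclosed_compact _ _ (f @` (`[-1, 1]%classic `*` `[-1, 1]%classic))).
- rewrite closedE => p; apply: contra_notP => /negP; rewrite norm_le1 -ltNge => p1.
  apply/nbhs_ballP; exists (normc p - 1)%:C; first by rewrite /= ltcR subr_gt0.
  move=> w; rewrite /ball /= norm_normc ltcR => pw; apply/negP; rewrite norm_le1 -ltNge.
  by have := normc_sub_le w p; lra.
- apply: continuous_compact; first exact: continuous_subspaceT.
  by apply: compact_setX; exact: segment_compact.
- move=> [x y] /=; rewrite norm_le1 => xy; exists (x, y) => //.
  have := normc_sqr (x +i* y); have := normc_ge0 (x +i* y); move: xy.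
  move: (normc _) => n n1 n0 /= nE.
  by split; rewrite /= in_itv /=; apply/andP; split; nra.
Unshelve. all: by end_near.
Qed.

Lemma compact_polydisc : compact (cpolydisc I R).
Proof. exact: (@tychonoff {classic I} (fun=> CC R) _ (fun=> compact_disc)). Qed.

(** With M at least 1, one can divide by M, and e <= M e holds for e >= 0. *)
Lemma polydisc_bounded (f : CI I R -> CC R) : {within cpolydisc I R, continuous f} ->
  exists2 M : R, 1 <= M & forall z, cpolydisc I R z -> normc (f z) <= M.
Proof.
move=> fc; have c0 : cpolydisc I R !=set0 by exists (fun=> 0) => i; rewrite normr0 ler01.
have nc : {within cpolydisc I R, continuous (fun z => normc (f z))}.
  apply/subspace_continuousP => z Dz; apply/cvgrPdist_le => e e0.
  have [s [d d0 H]] := within_closeP fc Dz e0.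
  apply: filterS (close_nbhs z s d0) => y sy Dy; have := H y Dy sy => h.
  rewrite /from_subspace ler_norml; apply/andP; split.
    by have := normc_sub_le (f z) (f y); lra.
  by have := normc_sub_le (f y) (f z); rewrite (normcBC (f z)); lra.
have [z0 _ zmax] := compact_EVT_max c0 compact_polydisc nc.
exists (Num.max 1 (normc (f z0))); first by rewrite le_max lexx.
by move=> z Dz; rewrite le_max zmax ?orbT // inE.
Qed.

(** A Lebesgue number argument: continuity gives a finite set of coordinates and a radius at each
    point of K, and compactness makes them uniform. *)
Lemma small_near_compact (f : CI I R -> CC R) (K : set (CI I R)) (e : R) :
  {within cpolydisc I R, continuous f} -> compact K -> K `<=` cpolydisc I R ->
  (forall x, K x -> f x = 0) -> 0 < e ->
  exists s, exists2 d : R, 0 < d &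
    forall x y, K x -> cpolydisc I R y -> close s d x y -> normc (f y) <= e.
Proof.
move=> fc /compact_near_coveringP Kc KD K0 e0.
(* Filter of "s large and d small", for the near-covering form of compactness. *)
pose F := [set A : set (seq {classic I} * R) | exists s0, exists2 d0 : R, 0 < d0 &
  forall s d, {subset s0 <= s} -> 0 < d <= d0 -> A (s, d)].
have FF : Filter F.
  split.
  - by exists [::], 1.
  - move=> P Q [s [d d0 sP]] [t [r r0 tQ]]; exists (s ++ t), (Num.min d r).
      by rewrite lt_min d0.
    move=> u x su; rewrite le_min => /and3P[x0 xd xr]; split.
      by apply: sP; rewrite ?x0 // => i si; apply: su; rewrite mem_cat si.
    by apply: tQ; rewrite ?x0 // => i si; apply: su; rewrite mem_cat si orbT.
  - by move=> P Q PQ [s [d d0 sP]]; exists s, d => // u x us xd; apply: PQ; exact: sP.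
pose P (p : seq {classic I} * R) x :=
  forall y, cpolydisc I R y -> close p.1 p.2 x y -> normc (f y) <= e.
have : F (fun p => K `<=` P p).
  apply: (Kc _ F P) => x Kx.
  have [s [d d0 H]] := within_closeP fc (KD _ Kx) e0.
  have d20 : 0 < d / 2 by rewrite divr_gt0.
  (* Half the radius is spent on moving from x to x', the other half on moving from x' to y. *)
  exists (close s (d / 2) x, [set p : seq {classic I} * R | {subset s <= p.1} /\ 0 < p.2 <= d / 2]).
    by split; [exact: close_nbhs|exists s, (d / 2)].
  move=> [x' [t r]] /= [xx' [st /andP[r0 rd]]] y Dy yt.
  have := H y Dy; rewrite (K0 x Kx) subr0; apply => i si.
  have -> : y i - x i = (y i - x' i) + (x' i - x i) by rewrite addrA subrK.
  apply: le_lt_trans (normcD _ _) _; rewrite (splitr d) ltrD ?xx' //.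
  by apply: lt_le_trans rd; apply: yt; exact: st.
move=> [s [d d0 H]]; exists s, d => // x y Kx Dy sxy.
by apply: (H s d _ _ x Kx y Dy sxy) => //; rewrite d0 lexx.
Qed.

End PolydiscTopology.

(** * Measure of the product cells *)

Section CellMeasure.
Context {R : realType} {I : Type}.
Variable m : nat.
Hypothesis m0 : (0 < m)%N.
Implicit Types (z c : CI I R) (s : seq {classic I}).

Lemma closed_cell s c l : (forall i, normc (c i) < 1) -> closed (cell m s c l).
Proof.
move=> c1; rewrite (_ : cell m s c l = \bigcap_(i in [set i : I | Stdlib.Lists.List.In i s])
   (proj (i : {classic I}) : CI I R -> CC R) @^-1` mobius_arc (c i) m (nth 0%N l (index (i : {classic I}) s))).
  apply: closed_bigI => i _; apply: preimage_closed; last exact: closed_arc.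
  by move=> z _; exact: (@proj_continuous {classic I} (fun=> CC R) i).
by apply/seteqP; split => z H i /H.
Qed.

Lemma prode_le (J : Type) (l : seq J) (f : J -> \bar R) (g : J -> R) :
  (forall j, 0 <= f j)%E -> (forall j, Stdlib.Lists.List.In j l -> f j <= (g j)%:E)%E ->
  (\prod_(j <- l) f j <= (\prod_(j <- l) g j)%:E)%E.
Proof.
move=> f0; elim: l => [|j l IH] H; first by rewrite !big_nil.
rewrite !big_cons EFinM lee_pmul //; last by apply: IH => i li; apply: H; right.
- by elim: (l) => [|i l' IH']; rewrite ?big_nil ?big_cons ?lee_fin ?ler01 // mule_ge0.
- by apply: H; left.
Qed.

(** At most [size J0] entries of s carry the factor W, however long s is. *)
Lemma prod_support_le s (J0 : seq {classic I}) c (W : R) : 1 <= W -> uniq s ->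
  (forall i : {classic I}, c i != 0 -> i \in J0) ->
  \prod_(i <- s) (if c i == 0 then 1 else W) <= W ^+ size J0.
Proof.
move=> W1 us cJ; apply: (@le_trans _ _ (W ^+ size [seq i <- s | c (i : {classic I}) != 0])).
  elim: (s) => [|i l IH]; first by rewrite big_nil.
  rewrite big_cons /=; case: eqP => _ /=; first by rewrite mul1r.
  by rewrite exprS ler_wpM2l // (le_trans ler01).
apply: ler_weXn2l => //; apply: uniq_leq_size; first exact: filter_uniq.
by move=> i; rewrite mem_filter => /andP[/cJ].
Qed.

(** Coordinates where c vanishes contribute at most 1 / m, and those in the support lose a factor 32
    / (1 - rho). The resulting constant depends on neither s nor m. *)
Lemma measure_cell_le (lam : {measure set (BCI I R) -> \bar R}) s (J0 : seq {classic I}) c (rho : R) l :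
  product_haar I R lam -> 0 <= rho < 1 -> (forall i, normc (c i) <= rho) -> uniq s ->
  (forall i : {classic I}, c i != 0 -> i \in J0) -> l \in multi_indices m (size s) ->
  (lam (cell m s c l) <= ((32 / (1 - rho)) ^+ size J0 / m%:R ^+ size s)%:E)%E.
Proof.
move=> [_ _ lamP _ _] /andP[r0 r1] cr us cJ ls.
have c1 i : normc (c i) < 1 by exact: le_lt_trans (cr i) r1.
have m0' : 0 < m%:R :> R by rewrite ltr0n.
rewrite /cell (lamP s (fun i => mobius_arc (c i) m (nth 0%N l (index (i : {classic I}) s)))); last first.
- by move=> i; apply: closed_borel; exact: closed_arc.
- exact: NoDup_uniq.
pose W : R := 32 / (1 - rho); have W1 : 1 <= W by rewrite ler_pdivlMr ?subr_gt0 //; lra.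
apply: (@le_trans _ _ (\prod_(i <- s) ((if c i == 0 then 1 else W) / m%:R))%:E).
  apply: prode_le => [i|i _]; first exact: haarT_ge0.
  have [->|ci0] := eqVneq (c i) 0; first by apply: haarT_arc0; exact: (multi_indices_lt m0 _ ls).
  apply: le_trans (haarT_arc _ (c1 i) m0) _.
  rewrite lee_fin ler_wpM2r ?invr_ge0 ?(ltW m0') // /W ler_wpM2l //.
  by rewrite lef_pV2 ?posrE ?subr_gt0 // lerB.
rewrite lee_fin big_split /= ler_pM ?prodr_ge0 //.
- by move=> i _; case: ifP => // _; exact: le_trans W1.
- exact: prod_support_le.
- by rewrite big_const_seq count_predT iter_mulr_1 exprVn.
Qed.

Lemma measure_le_sum (d : measure_display) (T : measurableType d) (mu : {measure set T -> \bar R})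
    (J : eqType) (l : seq J) (P : pred J) (F : J -> set T) (K : set T) :
  measurable K -> (forall j, measurable (F j)) ->
  (forall x, K x -> exists2 j, j \in l & P j /\ F j x) ->
  (mu K <= \sum_(j <- l | P j) mu (F j))%E.
Proof.
move=> mK mF KF.
have mU l' : measurable (\big[setU/set0]_(j <- l' | P j) F j) by apply: bigsetU_measurable.
apply: (@le_trans _ _ (mu (\big[setU/set0]_(j <- l | P j) F j))).
  apply: le_measure; rewrite ?inE // => x /KF[j jl [Pj Fx]].
  move: jl; elim: (l) => // k l' IH; rewrite inE big_cons => /predU1P[<-|jl].
    by rewrite Pj; left.
  by case: ifP => _; [right|]; exact: IH.
elim: (l) => [|j l' IH]; first by rewrite !big_nil measure0.
rewrite !big_cons; case: ifP => // _.
by apply: le_trans (measureU2 _ (mF j) (mU l')) _; rewrite leeD2l.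
Qed.

End CellMeasure.

(** * The uniqueness theorem *)

Section Uniqueness.
Context {R : realType} {I : Type}.
Variables (lam : {measure set (BCI I R) -> \bar R}) (Hlam : product_haar I R lam).
Variables (K : set (CI I R)) (KT : K `<=` torus I R) (Kcpt : compact K).
Hypothesis lamK : (0 < lam K)%E.

Lemma torus_sub_polydisc : torus I R `<=` cpolydisc I R.
Proof. by move=> z Tz i; rewrite Tz. Qed.

Lemma measurable_closed (A : set (CI I R)) : closed A -> measurable (A : set (BCI I R)).
Proof. exact: closed_borel. Qed.

Lemma closed_of_compact : closed K.
Proof.
apply: compact_closed => //.
by apply: (@hausdorff_product {classic I} (fun=> CC R)) => i; exact: norm_hausdorff.
Qed.

Lemma prodr_seq_if (T : Type) (l : seq T) (P : pred T) (e : R) :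
  \prod_(j <- l) (if P j then e else 1) = e ^+ count P l.
Proof.
elim: l => [|j l IH]; first by rewrite big_nil.
by rewrite big_cons IH /=; case: (P j); rewrite ?mul1r // add1n exprS.
Qed.

(** The cells that meet K cover it, so their number times the bound on the measure of one cell is at
    least [lam K]. *)
Lemma count_hit_cells (c : CI I R) (J0 s : seq {classic I}) (rho k0 : R) m :
  (0 < m)%N -> 0 <= rho < 1 -> (forall i, normc (c i) <= rho) ->
  (forall i : {classic I}, c i != 0 -> i \in J0) -> uniq s ->
  (k0%:E <= lam K)%E ->
  k0 * m%:R ^+ size s <= (32 / (1 - rho)) ^+ size J0 *
    (count (fun l => `[< exists2 x, K x & cell m s c l x >]) (multi_indices m (size s)))%:R.
Proof.
move=> m0 rho01 cr cJ us k0K; have /andP[r0 r1] := rho01.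
have c1 i : normc (c i) < 1 by exact: le_lt_trans (cr i) r1.
pose P l := `[< exists2 x, K x & cell m s c l x >].
have mn0 : 0 < m%:R ^+ size s :> R by rewrite exprn_gt0 // ltr0n.
set B := (32 / (1 - rho)) ^+ size J0.
suff : (lam K <= (B / m%:R ^+ size s * (count P (multi_indices m (size s)))%:R)%:E)%E.
  by move=> /(le_trans k0K); rewrite lee_fin mulrAC ler_pdivlMr.
apply: (@le_trans _ _ (\sum_(l <- multi_indices m (size s) | P l) lam (cell m s c l))%E).
  apply: measure_le_sum.
  - by apply: measurable_closed; exact: closed_of_compact.
  - by move=> l; apply: measurable_closed; exact: closed_cell.
  - move=> x Kx; have x1 i : normc (x i) = 1 by apply/norm_eq1; exact: KT.
    have [l ls xl] := cell_cover m0 s c1 x1.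
    by exists l => //; split => //; apply/asboolP; exists x.
apply: (@le_trans _ _ (\sum_(l <- multi_indices m (size s) | P l) (B / m%:R ^+ size s)%:E)%E).
  rewrite big_seq_cond [leRHS]big_seq_cond; apply: lee_sum => l /andP[ls _].
  exact: measure_cell_le.
by rewrite sumEFin big_const_seq iter_addr_0 mulr_natr.
Qed.

(** Of the N cells, n with N <= p n meet K, where p is fixed before e. With x = |h c| / M, sampling
    gives x^N <= e^n, hence x^p <= e for every e in (0, 1]. *)
Lemma zero_at_finite_support (h : CI I R -> CC R) (c : CI I R) (J0 : seq {classic I}) (rho : R) :
  {within cpolydisc I R, continuous h} ->
  (forall (i : I) z w, (forall j, normc (z j) <= 1) -> normc w < 1 ->
     derivable (fun w : CC R => h (upd I R z i w)) w 1) ->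
  (forall x, K x -> h x = 0) ->
  0 <= rho < 1 -> (forall i, normc (c i) <= rho) ->
  (forall i : {classic I}, c i != 0 -> i \in J0) -> h c = 0.
Proof.
move=> hc hd hK rho01 cr cJ; have /andP[r0 r1] := rho01.
have c1 i : normc (c i) < 1 by exact: le_lt_trans (cr i) r1.
have [M M1 hM] := polydisc_bounded hc.
have M0 : 0 < M by exact: lt_le_trans M1.
have [k0 k00 k0K] : exists2 k0 : R, 0 < k0 & (k0%:E <= lam K)%E.
  move: lamK; case: (lam K) => [r| |] //; first by rewrite lte_fin => r0'; exists r.
  by exists 1; rewrite ?leey.
pose B : R := (32 / (1 - rho)) ^+ size J0.
have B0 : 0 <= B by rewrite exprn_ge0 // divr_ge0 // subr_ge0 ltW.
pose p := (Num.truncn (B / k0)).+1.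
have pB : B <= p%:R * k0.
  by rewrite -ler_pdivrMr //; apply: ltW; rewrite truncnS_gt.
pose L : R := 2 / (1 - rho); have L0 : 0 < L by rewrite divr_gt0 // subr_gt0.
have key e : 0 < e -> e <= 1 -> (normc (h c) / M) ^+ p <= e.
  move=> e0 e1.
  have [s1 [d d0 Hs]] := small_near_compact hc Kcpt (subset_trans KT torus_sub_polydisc) hK e0.
  pose s := undup s1; have us : uniq s by exact: undup_uniq.
  (* A sample is off its cell by a radial error, governed by [sg], and an angular one, governed by
     m; each is given d / 2. Below, e^sg = 1 - q. *)
  have [sg sg0 sgd] : exists2 sg : R, sg < 0 & L * (1 - expR sg) < d / 2.
    pose q := Num.min (1 / 2) (d / (4 * L)).
    have q0 : 0 < q by rewrite lt_min !divr_gt0 // mulr_gt0.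
    have q1 : q <= 1 / 2 by rewrite ge_min lexx.
    have qd : L * q < d / 2.
      apply: (@le_lt_trans _ _ (L * (d / (4 * L)))).
        by rewrite ler_wpM2l ?(ltW L0) // ge_min lexx orbT.
      have -> : L * (d / (4 * L)) = d / 4 by field; rewrite gt_eqF.
      by lra.
    exists (ln (1 - q)); first by apply: ln_lt0; apply/andP; split; lra.
    by rewrite lnK ?posrE; lra.
  have [m m0 md] : exists2 m, (0 < m)%N & L * (2 * (2 * pi / m%:R)) < d / 2.
    pose x : R := L * (8 * pi) / d; exists (Num.truncn x).+1 => //.
    have := truncnS_gt x; rewrite {1}/x ltr_pdivrMr // => hx.
    set n := (Num.truncn x).+1 in hx *.
    have n0 : 0 < n%:R :> R by rewrite ltr0n.
    have -> : L * (2 * (2 * pi / n%:R)) = L * (8 * pi) / n%:R / 2 by field; rewrite gt_eqF.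
    by rewrite ltr_pM2r // ltr_pdivrMr // [d * _]mulrC.
  have [P [P1 _ Parc Pprod]] := product_sample m0 sg0 c1 hd us c1 (fun i _ => erefl).
  pose hit l := `[< exists2 x, K x & cell m s c l x >].
  have Ph l : normc (h (P l)) <= M * (if hit l then e else 1).
    have DP : cpolydisc I R (P l) by move=> i; rewrite norm_le1 ltW.
    rewrite /hit; case: asboolP => [[x Kx xl]|_]; last by rewrite mulr1 hM.
    apply: (@le_trans _ _ e); last by rewrite ler_peMl // ltW.
    apply: (Hs x (P l) Kx DP) => i; rewrite -mem_undup -/s => si.
    have [t -> /andP[t1 t2]] := Parc l i si.
    have [u + <-] := xl i ((In_mem s i).2 si).
    rewrite /= in_itv /= => /andP[u1 u2].
    move: t1 t2 u1 u2; move: (nth _ _ _) => k.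
    rewrite -!natr1 !mulrDl !mul1r => t1 t2 u1 u2.
    apply: le_lt_trans (mobius_polar_dist (c1 i) t u (ltW sg0)) _.
    have e10 : 0 <= 1 - expR sg by rewrite subr_ge0 expR_le1 ltW.
    have tu : `|t - u| <= 2 * pi / m%:R by rewrite ler_norml; apply/andP; split; lra.
    have hL : 2 / (1 - normc (c i)) <= L.
      by rewrite /L ler_wpM2l // lef_pV2 ?posrE ?subr_gt0 // lerB.
    apply: (@le_lt_trans _ _ (L * (1 - expR sg + 2 * (2 * pi / m%:R)))).
      apply: ler_pM => //; [by rewrite divr_ge0 // subr_ge0 ltW|by rewrite addr_ge0 // mulr_ge0|].
      by rewrite lerD2l ler_wpM2l.
    by rewrite mulrDr (splitr d) ltrD.
  have cnt := count_hit_cells m0 rho01 cr cJ us k0K.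
  set N := (m ^ size s)%N in Pprod; have N0 : (0 < N)%N by rewrite expn_gt0 m0.
  set n := count _ _ in cnt.
  have Nn : (N <= p * n)%N.
    rewrite -(ler_nat R) natrM natrX -(ler_pM2l k00); apply: le_trans cnt _.
    by rewrite mulrA [k0 * _]mulrC ler_wpM2r.
  have x0 : 0 <= normc (h c) / M by rewrite divr_ge0 ?normc_ge0 // ltW.
  have xN : (normc (h c) / M) ^+ N <= e ^+ n.
    rewrite expr_div_n ler_pdivrMr ?exprn_gt0 //; apply: le_trans Pprod _.
    apply: le_trans (_ : \prod_(l <- multi_indices m (size s)) (M * (if hit l then e else 1)) <= _).
      by apply: ler_prod => l _; rewrite normc_ge0 Ph.
    by rewrite big_split /= prodr_seq_if big_const_seq count_predT iter_mulr_1 size_multi_indices mulrC.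
  (* Compare N-th powers: (x^p)^N = (x^N)^p <= e^(n p) <= e^N, because e <= 1 and N <= p n. *)
  rewrite -(ler_pXn2r N0) ?nnegrE ?exprn_ge0 ?(ltW e0) //.
  rewrite exprAC; apply: (@le_trans _ _ ((e ^+ n) ^+ p)).
    by apply: lerXn2r; rewrite ?nnegrE ?exprn_ge0 // ltW.
  by rewrite -exprM mulnC; apply: ler_wiXn2l => //; rewrite ltW.
apply/eqP; rewrite -normc_eq0; apply/eqP.
have x0 : 0 <= normc (h c) / M by rewrite divr_ge0 ?normc_ge0 // ltW.
have : (normc (h c) / M) ^+ p <= 0.
  apply/ler_addgt0Pl => e e0; rewrite addr0.
  apply: le_trans (key (Num.min 1 e) _ _) _; rewrite ?lt_min ?ltr01 ?e0 ?ge_min ?lexx ?orbT //.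
rewrite le_eqVlt ltNge exprn_ge0 // orbF expf_eq0 /= mulf_eq0 invr_eq0 (gt_eqF M0) orbF.
by move/eqP.
Qed.

End Uniqueness.

Unset Implicit Arguments.

Theorem theorem3p5 (R : realType) (I : Type) (I_ne : inhabited I)
  (lam : {measure set (BCI I R) -> \bar R}) (Hlam : product_haar I R lam)
  (K : set (CI I R)) (KT : K `<=` torus I R) (Kcpt : compact K)
  (lamK : (0 < lam K)%E)
  (f g : CI I R -> CC R) (hf : A_polydisc I R f) (hg : A_polydisc I R g)
  (hfg : forall z, K z -> f z = g z) :
  forall z, cpolydisc I R z -> f z = g z.
Proof.
move=> z Dz; pose h (z : CI I R) : CC R := f z - g z.
have hc : {within cpolydisc I R, continuous h}.
  by move=> x; apply: cvgB; [exact: hf.1|exact: hg.1].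
have hd (i : I) y w : (forall j, normc (y j) <= 1) -> normc w < 1 ->
    derivable (fun w : CC R => h (upd I R y i w)) w 1.
  move=> y1 w1; have Dy : cpolydisc I R y by move=> j; rewrite norm_le1.
  have w1' : `|w| < 1 by rewrite norm_lt1.
  have df := (hf.2 i y Dy).2 w w1'; have dg := (hg.2 i y Dy).2 w w1'.
  exact: (@derivableB _ _ _ (fun w => f (upd I R y i w)) (fun w => g (upd I R y i w)) w 1 df dg).
have hK x : K x -> h x = 0 by move=> Kx; rewrite /h hfg // subrr.
apply/eqP; rewrite -subr_eq0 -/(h z) -normc_eq0 eq_le normc_ge0 andbT.
apply/ler_addgt0Pl => e e0; rewrite addr0.
have [s [d d0 H]] := within_closeP hc Dz e0.
(* The point z is cut off outside s and shrunk by 1 - q: the result has finite support, coordinates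
   of modulus at most 1 - q < 1, and differs from z by at most q < d on s. *)
pose q := Num.min (1 / 2) (d / 2).
have q0 : 0 < q by rewrite lt_min !divr_gt0.
have qh : q <= 1 / 2 by rewrite ge_min lexx.
have qd : q < d by rewrite gt_min; apply/orP; right; lra.
pose c : CI I R := fun i => if (i : {classic I}) \in s then (1 - q)%:C * z i else 0.
have z1 i : normc (z i) <= 1 by rewrite -norm_le1; exact: Dz.
have cq i : normc (c i) <= 1 - q.
  rewrite /c; case: ifP => _; last by rewrite normc0; lra.
  rewrite normcM normc_real ger0_norm; last lra.
  by rewrite ler_piMr //; lra.
have c0 : h c = 0.
  apply: (@zero_at_finite_support _ _ _ Hlam _ KT Kcpt lamK h c s (1 - q)) => //.
    by apply/andP; split; lra.
  by move=> i; rewrite /c; case: ifP => //; rewrite eqxx.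
have := H c; rewrite c0 sub0r normc_opp; apply.
  by move=> i; rewrite norm_le1; apply: le_trans (cq i) _; lra.
move=> i si; rewrite /c si.
have -> : (1 - q)%:C * z i - z i = - (q%:C * z i) by rewrite rmorphB /= rmorph1; ring.
rewrite normc_opp normcM normc_real gtr0_norm //; apply: le_lt_trans qd.
by rewrite ler_piMr // ltW.
Qed.
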